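(* Let $p\ge 2$ be an integer and let $\beta>\beta_0>\beta^*(p)$. The Bahadur slopes of $\hat{\beta}_{\mathrm{MPL}}$ and $\hat{\beta}_{\mathrm{ML}}$ for the $p$-tensor Curie-Weiss model at the alternative $\beta$ (for testing $H_0:\beta=\beta_0$ against $H_1:\beta>\beta_0$) exist and are respectively given by $$c_{\hat{\beta}_{\mathrm{MPL}}}(\beta_0,\beta,p) = 2\left(\sup_{x\in [-1,1]} H_{\beta_0,p}(x) - \sup_{x \in \eta_p^{-1} ((\beta,\infty))} H_{\beta_0,p}(x)\right),$$ $$c_{\hat{\beta}_{\mathrm{ML}}}(\beta_0,\beta,p) = 2\left(\sup_{x\in [-1,1]} H_{\beta_0,p}(x) - \sup_{x\in[-1,1],\ x > m_*(\beta,p)} H_{\beta_0,p}(x)\right).$$ Consequently, the minimum sample sizes required so that the tests based on $\sqrt{n}(\hat{\beta}_{\mathrm{MPL}}-\beta_0)$ and $\sqrt{n}(\hat{\beta}_{\mathrm{ML}}-\beta_0)$ become (and remain) significant at level $\delta$ satisfy, as $\delta\to 0$, $$N_{\hat{\beta}_{\mathrm{MPL}}}(\beta_0,\beta,\delta,p) \sim \frac{\log(\delta)}{\sup_{x \in \eta_p^{-1} ((\beta,\infty))} H_{\beta_0,p}(x)-\sup_{x\in [-1,1]} H_{\beta_0,p}(x)},$$ $$N_{\hat{\beta}_{\mathrm{ML}}}(\beta_0,\beta,\delta,p) \sim \frac{\log(\delta)}{\sup_{x\in[-1,1],\ x > m_*(\beta,p)} H_{\beta_0,p}(x) - \sup_{x\in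 [-1,1]} H_{\beta_0,p}(x) }.$$
   Context: **Model.** For an integer $p\ge2$ and $n\ge 1$, the $p$-tensor Curie-Weiss model with parameter $\beta$ is the probability mass function on $\{-1,1\}^n$ $$\mathbb{P}_{\beta,p}(x)=\frac{\exp\{\beta n^{1-p}\sum_{1\le i_1,\dots,i_p\le n}x_{i_1}\cdots x_{i_p}\}}{2^nZ_n(\beta,p)},$$ with $Z_n(\beta,p)$ the normalizing constant. $X=(X_1,\dots,X_n)$ denotes a sample from it and $\overline{X}_n=\frac1n\sum_{i=1}^nX_i$; $n$ is called the sample size. **Functions and threshold.** For $x\in[-1,1]$ (with $0\log0=0$), $$H_{\beta,p}(x)=\beta x^p-\tfrac12\{(1+x)\log(1+x)+(1-x)\log(1-x)\}.$$ $\beta^*(p)=\sup\{\beta\ge0:\sup_{x\in[-1,1]}H_{\beta,p}(x)=0\}$. For $\beta>\beta^*(p)$, $m_*(\beta,p)\in(0,1)$ denotes the unique positive global maximizer of $H_{\beta,p}$. The function $\eta_p$ on $[-1,1]$ is $\eta_p(t)=p^{-1}t^{1-p}\tanh^{-1}(t)$ for $t\ne0$ and $\eta_p(0)=0$ (with values in the extended reals at $t=\pm1$). **Estimators.** $\hat{\beta}_{\mathrm{ML}}$ is the maximum likelihood estimator of $\beta$, i.e. the maximizer of $\beta\mapsto\mathbb{P}_{\beta,p}(X)$ (equal to $\pm\infty$ if the supremum is only approached at $\pm\infty$). The maximum pseudolikelihood estimator is given explicitly by $\hat{\beta}_{\mathrm{MPL}}=\eta_p(\overline{X}_n)$. **Bahadur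 slope.** Consider testing $H_0:\beta=\beta_0$ versus $H_1:\beta>\beta_0$ with $\beta_0>\beta^*(p)$ using $T_n=\sqrt n(\hat\beta-\beta_0)$, where $\hat\beta$ is $\hat{\beta}_{\mathrm{ML}}$ or $\hat{\beta}_{\mathrm{MPL}}$, large values being significant. Let $F_{T_n,\beta_0}$ be the cumulative distribution function of $T_n$ under $\mathbb{P}_{\beta_0,p}$ and $L_n=1-F_{T_n,\beta_0}(T_n)$ (the $p$-value). The (weak) Bahadur slope of $\hat\beta$ at the alternative $\beta$ is the constant $c_{\hat\beta}(\beta_0,\beta,p)$ such that $\frac1n\log L_n\to-\frac12c_{\hat\beta}(\beta_0,\beta,p)$ in probability as $n\to\infty$ when $X\sim\mathbb{P}_{\beta,p}$. **Sample size.** With the samples for all $n$ (each with law $\mathbb{P}_{\beta,p}$) defined on a common probability space, $N_{\hat\beta}(\beta_0,\beta,\delta,p)=\inf\{N\ge1:\sup_{n\ge N}L_n\le\delta\}$. Here $a(\delta)\sim b(\delta)$ means $a(\delta)/b(\delta)\to1$ as $\delta\to0$, almost surely. *)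

(* Defs.v *)
From mathcomp Require Import all_boot all_order all_algebra.
From mathcomp Require Import all_classical all_reals all_analysis.
Set Implicit Arguments.
Unset Strict Implicit.
Unset Printing Implicit Defensive.
Import Order.TTheory GRing.Theory Num.Theory.
Import numFieldNormedType.Exports.
Local Open Scope classical_set_scope.
Local Open Scope ring_scope.

(* The cube {-1,1}^n is encoded by Boolean vectors, [true] standing for +1
   and [false] for -1; see [spin]. *)
Definition config (n : nat) : finType := {ffun 'I_n -> bool}.

Section CurieWeiss.
Context {R : realType}.
Implicit Types (p n : nat) (beta t x c : R).

Definition spin (s : bool) : R := if s then 1 else -1.

Definition hamiltonian p n (X : config n) : R :=
  n%:R ^ (1 - p%:Z) *
  \sum_(i : {ffun 'I_p -> 'I_n}) \prod_(k < p) spin (X (i k)).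

Definition partition_function p n beta : R :=
  (2 ^+ n)^-1 * \sum_(X : config n) expR (beta * hamiltonian p X).

Definition cw_pmf p n beta (X : config n) : R :=
  expR (beta * hamiltonian p X) / (2 ^+ n * partition_function p n beta).

Definition cw_prob p n beta (A : pred (config n)) : R :=
  \sum_(X : config n | A X) cw_pmf p beta X.

Definition sample_mean n (X : config n) : R :=
  n%:R^-1 * \sum_(i < n) spin (X i).

(* The convention 0 log 0 = 0 holds since [ln 0 = 0]. *)
Definition H beta p x : R :=
  beta * x ^+ p - 2^-1 * ((1 + x) * ln (1 + x) + (1 - x) * ln (1 - x)).

Definition sup_H beta p (A : set R) : R := sup [set H beta p x | x in A].

Definition beta_star p : R :=
  sup [set beta | 0 <= beta /\ sup_H beta p `[-1, 1] = 0].

Definition m_star beta p : R :=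
  xget 0 [set m | 0 < m < 1 /\ forall x, x \in `[-1, 1] -> H beta p x <= H beta p m].

(* Since [lne 0 = -oo], this takes the values -oo and +oo at -1 and 1.  It is
   only meaningful on [-1, 1]. *)
Definition atanhe t : \bar R :=
  (2^-1%:E * (lne (1 + t)%:E - lne (1 - t)%:E))%E.

Definition eta p t : \bar R :=
  if t == 0 then 0%E else ((p%:R^-1 * t ^ (1 - p%:Z))%:E * atanhe t)%E.

Definition eta_preimage_gt p beta : set R :=
  [set x | x \in `[-1, 1] /\ (beta%:E < eta p x < +oo)%E].

(* [b] is a maximizer over the real line of the likelihood of [X], or the
   infinite endpoint at which alone the supremum is approached. *)
Definition is_mle p n (X : config n) (b : \bar R) : Prop :=
  let lik t := cw_pmf p t X in
  let unattained := forall t, exists t', lik t < lik t' in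
  match b with
  | r%:E => forall t, lik t <= lik r
  | +oo%E => unattained /\ lik t @[t --> +oo] --> sup (range lik)
  | -oo%E => unattained /\ lik t @[t --> -oo] --> sup (range lik)
  end.

Definition estimator := forall n, config n -> \bar R.

(* The maximizer is unique except for n = 1 and p even, where the likelihood
   does not depend on the parameter and an arbitrary maximizer is taken. *)
Definition beta_ML p : estimator := fun n X => xget 0%E [set b | is_mle p X b].

Definition beta_MPL p : estimator := fun n X => eta p (sample_mean X).

Definition test_stat (est : estimator) beta0 n (X : config n) : \bar R :=
  ((Num.sqrt n%:R)%:E * (est n X - beta0%:E))%E.

Definition test_cdf p (est : estimator) beta0 n (s : \bar R) : R :=
  cw_prob p beta0 (fun Y : config n => (test_stat est beta0 Y <= s)%E).

Definition p_value p (est : estimator) beta0 n (X : config n) : R :=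
  1 - test_cdf p est beta0 n (test_stat est beta0 X).

(* The logarithm is extended-real valued because the p-value may vanish. *)
Definition is_bahadur_slope p (est : estimator) beta0 beta c : Prop :=
  forall e : R, 0 < e ->
    cw_prob p beta (fun X : config n =>
      (e%:E < `| n%:R^-1%:E * lne (p_value p est beta0 X)%:E
                 - (- (2^-1 * c))%:E |)%E)
      @[n --> \oo] --> (0 : R).

Definition min_sample_size (L : nat -> R) (delta : R) : \bar R :=
  ereal_inf [set (N%:R)%:E | N in
    [set N : nat | (1 <= N)%N /\
       (ereal_sup [set (L n)%:E | n in [set n | (N <= n)%N]] <= delta%:E)%E]].

(* No dependence structure is imposed between the samples of different sizes. *)
Definition cw_samples p beta d (Omega : measurableType d)
    (P : probability Omega R) (X : forall n, Omega -> config n) : Prop :=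
  forall n, (1 <= n)%N -> forall x : config n,
    measurable (X n @^-1` [set x]) /\
    P (X n @^-1` [set x]) = (cw_pmf p beta x)%:E.

Definition sample_size_equiv p (est : estimator) beta0
    (X : forall n, config n) (a : R -> R) : Prop :=
  (min_sample_size (fun n => p_value p est beta0 (X n)) delta
     * ((a delta)^-1)%:E)%E @[delta --> 0^'+] --> 1%E.

End CurieWeiss.

(* Main.v *)
(* Write [H] for [H beta p], [S] for its supremum over [-1,1], and
   [x = sample_mean X].  The energy is [n x^p] and a binomial coefficient
   'C(n,k) equals [n^n / (k^k (n-k)^(n-k))] up to a factor [n+1], so the
   event [x = 2k/n - 1] has weight [2^n e^(n H(x))] up to a polynomial factor.
   Hence [n^-1 ln (cw_prob p beta A)] is asymptotically [sup_A H - S], and the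
   sample mean is exponentially concentrated near the maximizers of [H].

   The p-value of [X] is the null probability that the estimator at a fresh
   sample [Y] exceeds its value at [X].  For the pseudolikelihood estimator
   this is the event [eta p y > eta p x]; for the maximum likelihood estimator
   it is [y^p > x^p], since the likelihood is that of an exponential family
   with statistic [n x^p].  Under [beta], [eta p x] is close to [beta] and [x^p]
   to [(m_star beta p)^p] outside an exponentially small event.  There the
   event has the rate of the limiting set, provided that the supremum of the
   null [H] is continuous in the threshold; for [eta p] this holds because
   [atanh x / x^(p-1)] is strictly quasiconvex on (0,1) and so has no local
   maximum.

   Exponential smallness of the exceptional events yields convergence in
   probability, and, by Borel-Cantelli, almost surely. *)
Require Import Defs.
From mathcomp Require Import all_boot all_order all_algebra.
From mathcomp Require Import all_classical all_reals all_analysis.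
From mathcomp Require Import lra ring.
Set Implicit Arguments.
Unset Strict Implicit.
Unset Printing Implicit Defensive.
Import Order.TTheory GRing.Theory Num.Theory.
Import numFieldNormedType.Exports.
Local Open Scope classical_set_scope.
Local Open Scope ring_scope.

(** * Counting configurations *)

(** For fixed k the terms k^j / j! have consecutive ratio k / (j+1), so they do not decrease before
    j = k and do not increase after it. *)
Lemma fact_expn_le (k j : nat) : (k`! * k ^ j <= j`! * k ^ k)%N.
Proof.
have up d m : ((m + d)`! <= m`! * (m + d) ^ d)%N.
  elim: d => [|d IH]; first by rewrite addn0 expn0 muln1.
  rewrite addnS factS expnS mulnCA leq_mul2l/=.
  apply: (leq_trans IH); rewrite leq_mul2l; apply/orP; right.
  by case: d {IH} => // d; rewrite leq_exp2r.
have dn d m : (m`! * m ^ d <= (m + d)`!)%N.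
  elim: d => [|d IH]; first by rewrite addn0 expn0 muln1.
  by rewrite addnS factS expnS mulnCA leq_mul// -addnS leq_addr.
have [/subnKC|/ltnW/subnKC] := leqP j k; move: (_ - _)%N => d <-.
  rewrite [in leqRHS]expnD (mulnC ((j + d) ^ j)%N) mulnA.
  by rewrite leq_mul2r up orbT.
by rewrite expnD mulnCA mulnC leq_mul2r dn orbT.
Qed.

(** Up to the factor n^n these are the weights of the binomial law of parameter k/n, whose mode is
    [k]. Multiplying out the factorials leaves [fact_expn_le] at [k] and at [n - k]. *)
Lemma binomial_mode (n k j : nat) : (k <= n)%N -> (j <= n)%N ->
  ('C(n, j) * (k ^ j * (n - k) ^ (n - j)) <=
   'C(n, k) * (k ^ k * (n - k) ^ (n - k)))%N.
Proof.
move=> kn jn.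
have fpos : (0 < (j`! * (n - j)`!) * (k`! * (n - k)`!))%N.
  by rewrite !muln_gt0 !fact_gt0.
rewrite -(leq_pmul2r fpos).
rewrite [leqLHS](_ : _ = 'C(n, j) * (j`! * (n - j)`!) *
  ((k`! * k ^ j) * ((n - k)`! * (n - k) ^ (n - j))))%N; last by ring.
rewrite [leqRHS](_ : _ = 'C(n, k) * (k`! * (n - k)`!) *
  ((j`! * k ^ k) * ((n - j)`! * (n - k) ^ (n - k))))%N; last by ring.
rewrite (bin_fact jn) (bin_fact kn).
by rewrite leq_mul2l leq_mul ?orbT// fact_expn_le.
Qed.

(** Expanding [(k + (n - k)) ^ n] gives n + 1 terms, each at most the mode. *)
Lemma binomial_pow_ge (n k : nat) : (k <= n)%N ->
  (n ^ n <= n.+1 * ('C(n, k) * (k ^ k * (n - k) ^ (n - k))))%N.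
Proof.
move=> kn; rewrite -{1}(subnK kn) expnDn.
apply: (@leq_trans (\sum_(i < n.+1) 'C(n, k) * (k ^ k * (n - k) ^ (n - k)))%N).
  apply: leq_sum => j _; rewrite [X in (_ * X)%N]mulnC.
  by apply: binomial_mode => //; rewrite -ltnS.
by rewrite sum_nat_const card_ord.
Qed.

Lemma binomial_pow_le (n k : nat) : (k <= n)%N ->
  ('C(n, k) * (k ^ k * (n - k) ^ (n - k)) <= n ^ n)%N.
Proof.
move=> kn; rewrite -{4}(subnK kn) [X in (_ <= X)%N]expnDn.
have kn' : (k < n.+1)%N by rewrite ltnS.
rewrite (bigD1 (Ordinal kn'))//= (mulnC (k ^ k)%N).
by rewrite ?subnK// leq_addr.
Qed.

Section Counting.
Context {R : realType}.
Implicit Types (p n k : nat) (beta x : R).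

Definition ups n (X : config n) : nat := #|finset X|.

Lemma ups_le n (X : config n) : (ups X <= n)%N.
Proof. by rewrite -[leqRHS]card_ord max_card. Qed.

Lemma card_ups n k : #|[pred X : config n | ups X == k]| = 'C(n, k).
Proof.
rewrite -[in RHS](card_ord n) -card_draws.
rewrite -(card_imset (f := fun X : config n => finset X)); last first.
  move=> X Y /setP XY; apply/ffunP => i.
  by have := XY i; rewrite !inE.
apply: eq_card => A; rewrite inE; apply/imsetP/idP => [[X]|Ak].
  by rewrite inE /ups => Xk ->.
have AE : finset [ffun i => i \in A] = A.
  by apply/setP => i; rewrite inE ffunE.
by exists [ffun i => i \in A]; rewrite ?AE// inE /ups AE.
Qed.

(** The sample mean of a configuration with [k] of its [n] spins equal to +1. *)
Definition lattice_mean n k : R := 2 * k%:R / n%:R - 1.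

Lemma sum_spin n (X : config n) :
  \sum_(i < n) spin (X i) = 2 * (ups X)%:R - n%:R :> R.
Proof.
rewrite /ups -sum1_card natr_sum mulr_sumr [in RHS]big_mkcond/=.
have -> : n%:R = \sum_(i < n) 1 :> R by rewrite sumr_const card_ord.
rewrite -sumrB.
apply: eq_bigr => i _; rewrite inE/= /spin mulr1.
by case: ifP => _; lra.
Qed.

Lemma sample_meanE n (X : config n) : (0 < n)%N ->
  sample_mean X = lattice_mean n (ups X).
Proof.
move=> n0; rewrite /sample_mean sum_spin /lattice_mean.
by field; rewrite pnatr_eq0 -lt0n.
Qed.

Lemma hamiltonianE p n (X : config n) : (0 < n)%N ->
  hamiltonian p X = n%:R * sample_mean X ^+ p :> R.
Proof.
move=> n0; rewrite /hamiltonian /sample_mean.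
have nR : n%:R != 0 :> R by rewrite pnatr_eq0 -lt0n.
have -> : \sum_(i : {ffun 'I_p -> 'I_n}) \prod_(k < p) spin (X (i k)) =
    (\sum_(i < n) spin (X i)) ^+ p :> R.
  by rewrite -(bigA_distr_bigA (fun _ j => spin (X j))) prodr_const card_ord.
by rewrite exprMn expfzDr// expr1z -exprnN exprVn mulrA.
Qed.

Lemma cw_pmfE p n beta (X : config n) :
  cw_pmf p beta X = expR (beta * hamiltonian p X) /
    \sum_(Y : config n) expR (beta * hamiltonian p Y).
Proof.
rewrite /cw_pmf /partition_function; congr (_ / _).
rewrite mulrA divff ?mul1r//.
Qed.

Lemma expR_entropy n k : (0 < n)%N -> (k <= n)%N ->
  let x := lattice_mean n k in
  expR (n%:R * (2^-1 * ((1 + x) * ln (1 + x) + (1 - x) * ln (1 - x)))) *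
    n%:R ^+ n = 2 ^+ n * (k%:R ^+ k * (n - k)%:R ^+ (n - k)).
Proof.
move=> n0 kn x.
have nR : n%:R != 0 :> R by rewrite pnatr_eq0 -lt0n.
have nR0 : 0 < n%:R :> R by rewrite ltr0n.
have pw j : expR (j%:R * ln (2 * j%:R / n%:R)) * n%:R ^+ j = 2 ^+ j * j%:R ^+ j :> R.
  (* At [j = 0] the conventions [ln 0 = 0] and [0 ^ 0 = 1] agree. *)
  case: j => [|j]; first by rewrite mul0r expR0 !expr0.
  rewrite expRM_natl lnK; last by rewrite posrE divr_gt0 ?mulr_gt0 ?ltr0n.
  by rewrite -!exprMn divfK.
have -> : n%:R * (2^-1 * ((1 + x) * ln (1 + x) + (1 - x) * ln (1 - x))) =
    k%:R * ln (2 * k%:R / n%:R) + (n - k)%:R * ln (2 * (n - k)%:R / n%:R).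
  have -> : 1 + x = 2 * k%:R / n%:R by rewrite /x/lattice_mean; lra.
  have -> : 1 - x = 2 * (n - k)%:R / n%:R.
    by rewrite /x/lattice_mean natrB//; field.
  by rewrite mulrA mulrDr; congr +%R; field.
have split_pow y : y ^+ n = y ^+ k * y ^+ (n - k) :> R by rewrite -exprD subnKC.
by rewrite expRD !split_pow mulrACA !pw mulrACA.
Qed.

(** The binomial bounds combined with the entropy identity turn the number of configurations of a
    given mean into 2^n times the exponential of n times the entropy part of [H], up to the factor n
    + 1. *)
Lemma binomial_weight p n k beta : (0 < n)%N -> (k <= n)%N ->
  2 ^+ n * expR (n%:R * H beta p (lattice_mean n k)) / n.+1%:R <=
    'C(n, k)%:R * expR (beta * (n%:R * lattice_mean n k ^+ p))
  <= 2 ^+ n * expR (n%:R * H beta p (lattice_mean n k)).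
Proof.
move=> n0 kn; set x := lattice_mean n k.
have nn0 : 0 < n%:R ^+ n :> R by rewrite exprn_gt0// ltr0n.
have := expR_entropy n0 kn; rewrite /= -/x /H.
set I := 2^-1 * _; move=> E.
have I0 := expR_gt0 (n%:R * I).
have -> : n%:R * (beta * x ^+ p - I) = beta * (n%:R * x ^+ p) - n%:R * I.
  by ring.
rewrite expRD expRN.
set F := expR (beta * _); have F0 : 0 < F by apply: expR_gt0.
have lo := binomial_pow_ge kn; have up := binomial_pow_le kn.
rewrite -(ler_nat R) !natrM !natrX in lo.
rewrite -(ler_nat R) !natrM !natrX in up.
have two0 : 0 < 2 ^+ n :> R by rewrite exprn_gt0.
apply/andP; split.
  rewrite ler_pdivrMr ?ltr0n// mulrA ler_pdivrMr//.
  rewrite -(ler_pM2r nn0) -[X in _ <= X]mulrA E.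
  rewrite [leLHS](_ : _ = 2 ^+ n * F * n%:R ^+ n); last by ring.
  rewrite [leRHS](_ : _ = 2 ^+ n * F * (n.+1%:R *
    ('C(n, k)%:R * (k%:R ^+ k * (n - k)%:R ^+ (n - k))))); last by ring.
  by rewrite ler_pM2l// mulr_gt0.
rewrite mulrA ler_pdivlMr// -(ler_pM2r nn0) -[X in X <= _]mulrA E.
rewrite [leRHS](_ : _ = 2 ^+ n * F * n%:R ^+ n); last by ring.
rewrite [leLHS](_ : _ = 2 ^+ n * F *
    ('C(n, k)%:R * (k%:R ^+ k * (n - k)%:R ^+ (n - k)))); last by ring.
by rewrite ler_pM2l// mulr_gt0.
Qed.

End Counting.

(** * Continuity of [H] and weights of the layers of equal mean *)

Section Rate.
Context {R : realType}.
Implicit Types (p n k : nat) (beta x : R).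

(** With [x = s ^ 2] this is [- s ln s <= 1], which follows from [ln (1/s) < 1/s]. It settles the
    continuity of [x ln x] at 0. *)
Lemma normr_xlnx_le x : x <= 1 -> `|x * ln x| <= 2 * Num.sqrt `|x|.
Proof.
move=> x1; have [x0|x0] := leP x 0.
  by rewrite ln0// mulr0 normr0 mulr_ge0// sqrtr_ge0.
set s := Num.sqrt x; have s0 : 0 < s by rewrite sqrtr_gt0.
have xs : x = s ^+ 2 by rewrite sqr_sqrtr// ltW.
have lnx : ln x <= 0 by rewrite ln_le0.
rewrite normrM (ger0_norm (ltW x0)) (ler0_norm lnx) -/s.
have lns : - ln s < s^-1 by rewrite -lnV ?posrE// ln_sublinear ?invr_gt0.
rewrite xs lnXn// expr2.
have : s * (- ln s) <= 1.
  by rewrite -(divff (lt0r_neq0 s0)) ler_pM2l// ltW.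
by move=> h; nra.
Qed.

Lemma continuous_xlnx : continuous (fun x : R => x * ln x).
Proof.
move=> x; have [x0|x0|->] := ltgtP x 0.
- apply: (@near_cst_continuous _ _ 0); near=> y.
  by rewrite ln0 ?mulr0//; near: y; exact: lt_le_nbhsl.
- by apply: cvgM; [exact: cvg_id|exact: continuous_ln].
- have sq0 : Num.sqrt `|y| @[y --> (0 : R)] --> (0 : R).
    have : Num.sqrt `|y| @[y --> (0 : R)] --> Num.sqrt `|0 : R|.
      by apply: (@continuous_comp _ _ _ (fun y : R => `|y|) Num.sqrt); [exact: norm_continuous|exact: sqrt_continuous].
    by rewrite normr0 sqrtr0.
  rewrite /continuous_at mul0r; apply/cvgr0Pnorm_le => e e0; near=> y.
  apply: (le_trans (normr_xlnx_le _)).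
    by near: y; apply: lt_le_nbhsl.
  rewrite -ler_pdivlMl//; apply: le_trans (ler_norm _) _.
  near: y; apply: (cvgr0_norm_le _ sq0).
  by rewrite mulr_gt0// invr_gt0.
Unshelve. all: by end_near. Qed.

Lemma continuous_H beta p : continuous (H beta p).
Proof.
have c1 : continuous (fun x : R => 1 + x).
  by move=> x; apply: cvgD; [exact: cvg_cst|exact: cvg_id].
have c2 : continuous (fun x : R => 1 - x).
  by move=> x; apply: cvgB; [exact: cvg_cst|exact: cvg_id].
have cp : continuous (fun x : R => (1 + x) * ln (1 + x)).
  move=> x; exact: (continuous_comp (c1 x) (@continuous_xlnx _)).
have cm : continuous (fun x : R => (1 - x) * ln (1 - x)).
  move=> x; exact: (continuous_comp (c2 x) (@continuous_xlnx _)).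
move=> x; rewrite /H.
apply: cvgB.
  by apply: cvgM; [exact: cvg_cst|exact: exprn_continuous].
by apply: cvgM; [exact: cvg_cst|apply: cvgD; [exact: cp|exact: cm]].
Qed.

Lemma H_le_sup beta p x : x \in `[-1, 1] -> H beta p x <= sup_H beta p `[-1, 1].
Proof.
move=> x1; apply: ub_le_sup; last by exists x.
have [c _ cmax] := @EVT_max R (H beta p) (-1) 1 ltac:(lra)
  (continuous_subspaceT (@continuous_H beta p)).
by exists (H beta p c) => _ [y y1 <-]; exact: cmax.
Qed.

Lemma sup_H_attained beta p : exists2 y, y \in `[-1, 1] &
  H beta p y = sup_H beta p `[-1, 1].
Proof.
have [c c1 cmax] := @EVT_max R (H beta p) (-1) 1 ltac:(lra)
  (continuous_subspaceT (@continuous_H beta p)).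
exists c => //; apply/eqP; rewrite eq_le H_le_sup//=.
by apply: ge_sup; [exists (H beta p c), c|move=> _ [y y1 <-]; exact: cmax].
Qed.

Lemma lattice_mean_itv n k : (0 < n)%N -> (k <= n)%N ->
  lattice_mean n k \in `[-1 : R, 1].
Proof.
move=> n0 kn; rewrite /lattice_mean in_itv/=.
have n0' : 0 < n%:R :> R by rewrite ltr0n.
have : 0 <= k%:R / n%:R :> R by rewrite divr_ge0.
have : k%:R / n%:R <= 1 :> R by rewrite ler_pdivrMr// mul1r ler_nat.
by rewrite -mulrA; move: (k%:R / n%:R) => t h1 h2; apply/andP; split; lra.
Qed.

Lemma lattice_mean_near n x : (0 < n)%N -> x \in `[-1, 1] ->
  exists2 k, (k <= n)%N & `|lattice_mean n k - x| <= 2 / n%:R.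
Proof.
move=> n0; rewrite in_itv/= => /andP[x0 x1].
have n0' : 0 < n%:R :> R by rewrite ltr0n.
have y0 : 0 <= n%:R * (1 + x) / 2 by rewrite divr_ge0// mulr_ge0//; lra.
(* [k] is the integer part of n (1 + x) / 2, the number of +1 spins that a mean of exactly [x] would
   require. *)
move: (Num.truncn _) (truncn_itv y0) => k /andP[k0 k1].
exists k.
  rewrite -(ler_nat R); apply: (le_trans k0).
  by rewrite ler_pdivrMr// ler_pM2l//; lra.
rewrite /lattice_mean [_ - x](_ : _ = (k%:R - n%:R * (1 + x) / 2) * (2 / n%:R)); last first.
  by field; rewrite lt0r_neq0.
rewrite normrM (ger0_norm (_ : 0 <= 2 / n%:R)) ?divr_ge0//.
rewrite ler_piMl ?divr_ge0// ler_norml.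
move: k0 k1; rewrite -natr1; move: (_ / 2) => t k0 k1; apply/andP; split; lra.
Qed.

Lemma near_natS_le_expR (e : R) : 0 < e ->
  \forall n \near \oo, n.+1%:R <= expR (n%:R * e).
Proof.
move=> e0; near=> n.
have n0 : 0 <= n%:R * e by rewrite mulr_ge0// ltW.
apply: le_trans (expR_ge1Dxn 1 n0).
rewrite -natr1 addrC lerD2l ler_pdivlMr ?ltr0n// exprMn expr2 -mulrA ler_wpM2l//.
by rewrite -ler_pdivrMr ?exprn_gt0//; near: n; exact: nbhs_infty_ger.
Unshelve. all: by end_near. Qed.

Lemma cw_weight_ge p n beta k (A : pred (config n)) : (0 < n)%N -> (k <= n)%N ->
  (forall X, ups X = k -> A X) ->
  2 ^+ n * expR (n%:R * H beta p (lattice_mean n k)) / n.+1%:R <=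
  \sum_(X : config n | A X) expR (beta * hamiltonian p X).
Proof.
move=> n0 kn Ak.
have /andP[lo _] := binomial_weight p beta n0 kn.
apply: (le_trans lo); rewrite (bigID (fun X => ups X == k))/=.
apply: ler_wpDr; first by apply: sumr_ge0 => X _; exact: expR_ge0.
rewrite (eq_bigl [pred X : config n | ups X == k]); last first.
  by move=> X /=; rewrite andb_idl// => /eqP /Ak.
rewrite (eq_bigr (fun=> expR (beta * (n%:R * lattice_mean n k ^+ p)))); last first.
  by move=> X /eqP Xk; rewrite hamiltonianE// sample_meanE// Xk.
by rewrite sumr_const card_ups mulr_natl.
Qed.

(** Split into n + 1 layers of equal mean: a layer that meets [A] has its mean where [H <= s], and
    the others contribute nothing. *)
Lemma cw_weight_le p n beta (A : pred (config n)) (s : R) : (0 < n)%N ->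
  (forall X, A X -> H beta p (sample_mean X) <= s) ->
  \sum_(X : config n | A X) expR (beta * hamiltonian p X) <=
  n.+1%:R * (2 ^+ n * expR (n%:R * s)).
Proof.
move=> n0 As.
rewrite (partition_big (fun X : config n => inord (ups X) : 'I_n.+1) xpredT)//=.
rewrite -[X in X%:R * _](card_ord n.+1) mulr_natl -sumr_const.
apply: ler_sum => k _.
have upsk (X : config n) : (inord (ups X) == k) = (ups X == k).
  by rewrite -val_eqE/= inordK// ltnS ups_le.
have [/existsP[X0 /andP[AX0 X0k]]|] := boolP [exists X : config n, A X && (inord (ups X) == k)]; last first.
  move=> /existsPn none; rewrite big1 ?mulr_ge0 ?exprn_ge0 ?expR_ge0// => X AX.
  by have := none X; rewrite AX.
have kn : (k <= n)%N by rewrite -ltnS.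
have /andP[_ up] := binomial_weight p beta n0 kn.
rewrite upsk in X0k; move/eqP : X0k => X0k.
apply: (@le_trans _ _ ('C(n, k)%:R * expR (beta * (n%:R * lattice_mean n k ^+ p)))); last first.
  apply: (le_trans up); rewrite ler_pM2l ?exprn_gt0// ler_expR ler_wpM2l//.
  by rewrite -X0k -sample_meanE//; exact: As.
rewrite -card_ups mulr_natl -sumr_const.
rewrite big_mkcond [leRHS]big_mkcond/=; apply: ler_sum => X _.
rewrite upsk !inE; case: ifP => [/andP[_ Xk]|_]; last by case: ifP; rewrite ?expR_ge0.
by rewrite Xk hamiltonianE// sample_meanE// (eqP Xk).
Qed.

End Rate.

(** * Large deviations of the sample mean *)

Section LD.
Context {R : realType}.
Implicit Types (p n k : nat) (beta x y r e s : R).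

Lemma cw_partition_gt0 p n beta :
  0 < \sum_(X : config n) expR (beta * hamiltonian p X) :> R.
Proof.
rewrite (bigD1 [ffun=> true])//= ltr_pwDl ?expR_gt0//.
by apply: sumr_ge0 => X _; exact: expR_ge0.
Qed.

Lemma cw_probE p n beta (A : pred (config n)) : cw_prob p beta A =
  (\sum_(X : config n | A X) expR (beta * hamiltonian p X)) /
    \sum_(X : config n) expR (beta * hamiltonian p X).
Proof.
by rewrite /cw_prob mulr_suml; apply: eq_bigr => X _; rewrite cw_pmfE.
Qed.

Lemma cw_pmf_ge0 p n beta (X : config n) : 0 <= cw_pmf p beta X.
Proof. by rewrite cw_pmfE divr_ge0 ?expR_ge0// ltW// cw_partition_gt0. Qed.

Lemma cw_prob_ge0 p n beta (A : pred (config n)) : 0 <= cw_prob p beta A.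
Proof. by apply: sumr_ge0 => X _; exact: cw_pmf_ge0. Qed.

Lemma cw_probC p n beta (A : pred (config n)) :
  1 - cw_prob p beta A = cw_prob p beta (predC A).
Proof.
have : cw_prob p beta (@predT (config n)) = 1.
  by rewrite cw_probE divff// lt0r_neq0// cw_partition_gt0.
by rewrite /cw_prob (bigID A)/= => <-; rewrite addrAC subrr add0r.
Qed.

Lemma near_lattice_H p beta y r e : y \in `[-1, 1] -> 0 < r -> 0 < e ->
  \forall n \near \oo, exists k, [/\ (k <= n)%N,
    `|lattice_mean n k - y| < r & H beta p y - e <= H beta p (lattice_mean n k)].
Proof.
move=> y1 r0 e0.
have := @continuous_H R beta p y => /cvgrPdist_le /(_ e e0) /nbhs_ballP[d /= d0 dH].
near=> n.
have n0 : (0 < n)%N by near: n; exact: nbhs_infty_gt.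
have [k kn ky] := lattice_mean_near n0 y1; exists k.
have nmin : 2 / n%:R < Num.min r d.
  rewrite ltr_pdivrMr ?ltr0n// -ltr_pdivrMl ?lt_min ?r0//.
  by near: n; exact: nbhs_infty_gtr.
move: (le_lt_trans ky nmin); rewrite lt_min => /andP[kr kd]; split => //.
have := dH (lattice_mean n k); rewrite /ball/= distrC => /(_ kd).
by rewrite ler_norml => /andP[_]; lra.
Unshelve. all: by end_near. Qed.

(** A single layer near a maximizer bounds the partition function from below. The threshold on [n]
    is uniform in [A] and [s], which matters because the rejection event will depend on the observed
    sample. *)
Lemma cw_prob_upper p beta e : 0 < e ->
  \forall n \near \oo, forall (A : pred (config n)) s,
    (forall X, A X -> H beta p (sample_mean X) <= s) ->
    cw_prob p beta A <=
      expR (n%:R * (s - sup_H beta p `[-1, 1] + e)).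
Proof.
move=> e0; have [y y1 yS] := sup_H_attained beta p.
(* One third of [e] pays for approximating the maximizer by the lattice, the other two for two
   factors n + 1. *)
have e3 : 0 < e / 3 by rewrite divr_gt0.
near=> n => A s As.
have n0 : (0 < n)%N by near: n; exact: nbhs_infty_gt.
have [k [kn _ yk]] : exists k, [/\ (k <= n)%N,
    `|lattice_mean n k - y| < 1 & H beta p y - e / 3 <= H beta p (lattice_mean n k)].
  by near: n; exact: near_lattice_H.
have nS : n.+1%:R <= expR (n%:R * (e / 3)).
  by near: n; exact: near_natS_le_expR.
rewrite cw_probE ler_pdivrMr ?cw_partition_gt0//.
apply: (le_trans (cw_weight_le n0 As)).
have := cw_weight_ge p beta n0 kn (A := xpredT) (fun _ _ => isT).
set Z := \sum_(X : config n | _) _ => ZE.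
have {ZE} : 2 ^+ n * expR (n%:R * (sup_H beta p `[-1, 1] - e / 3)) <= n.+1%:R * Z.
  rewrite -ler_pdivrMl ?ltr0n//; apply: le_trans ZE.
  rewrite [leRHS]mulrC ler_pM2l ?invr_gt0 ?ltr0n// ler_pM2l ?exprn_gt0//.
  by rewrite ler_expR ler_pM2l ?ltr0n// -yS.
move=> ZE.
have F0 := expR_gt0 (n%:R * (s - sup_H beta p `[-1, 1] + e / 3)).
apply: (@le_trans _ _ (n.+1%:R * (n.+1%:R * Z) * expR (n%:R * (s - sup_H beta p `[-1, 1] + e / 3)))).
  rewrite -[leRHS]mulrA ler_pM2l ?ltr0n//.
  rewrite (_ : n%:R * s = n%:R * (sup_H beta p `[-1, 1] - e / 3) +
    n%:R * (s - sup_H beta p `[-1, 1] + e / 3)); last by ring.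
  by rewrite expRD mulrA ler_pM2r.
rewrite (_ : n%:R * (s - sup_H beta p `[-1, 1] + e) = n%:R * (e / 3) + n%:R * (e / 3) +
  n%:R * (s - sup_H beta p `[-1, 1] + e / 3)); last by field.
rewrite !expRD mulrA mulrAC ler_pM2r ?cw_partition_gt0// ler_pM2r//.
by rewrite ler_pM.
Unshelve. all: by end_near. Qed.

(** One layer close to [y] bounds the event from below, and the n + 1 layers together bound the
    partition function from above. *)
Lemma cw_prob_lower p beta y r e : y \in `[-1, 1] -> 0 < r -> 0 < e ->
  \forall n \near \oo, forall A : pred (config n),
    (forall X, `|sample_mean X - y| < r -> A X) ->
    expR (n%:R * (H beta p y - sup_H beta p `[-1, 1] - e)) <= cw_prob p beta A.
Proof.
move=> y1 r0 e0; have e3 : 0 < e / 3 by rewrite divr_gt0.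
near=> n => A Ay.
have n0 : (0 < n)%N by near: n; exact: nbhs_infty_gt.
have [k [kn kr yk]] : exists k, [/\ (k <= n)%N,
    `|lattice_mean n k - y| < r & H beta p y - e / 3 <= H beta p (lattice_mean n k)].
  by near: n; exact: near_lattice_H.
have nS : n.+1%:R <= expR (n%:R * (e / 3)).
  by near: n; exact: near_natS_le_expR.
rewrite cw_probE ler_pdivlMr ?cw_partition_gt0//.
have Ak X : ups X = k -> A X by move=> Xk; apply: Ay; rewrite sample_meanE// Xk.
apply: le_trans (cw_weight_ge p beta n0 kn Ak).
rewrite ler_pdivlMr ?ltr0n//.
have ZS : \sum_(X : config n) expR (beta * hamiltonian p X) <=
    n.+1%:R * (2 ^+ n * expR (n%:R * sup_H beta p `[-1, 1])).
  apply: cw_weight_le => // X _; apply: H_le_sup.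
  by rewrite sample_meanE// lattice_mean_itv// ups_le.
set a := expR (n%:R * (e / 3)) in nS.
apply: (@le_trans _ _ (expR (n%:R * (H beta p y - sup_H beta p `[-1, 1] - e)) *
   (n.+1%:R * (2 ^+ n * expR (n%:R * sup_H beta p `[-1, 1]))) * n.+1%:R)).
  by rewrite ler_pM2r ?ltr0n// ler_pM2l ?expR_gt0.
apply: (@le_trans _ _ (2 ^+ n * (expR (n%:R * (H beta p y - sup_H beta p `[-1, 1] - e)) *
   expR (n%:R * sup_H beta p `[-1, 1])) * (a * a))).
  rewrite [leLHS](_ : _ = 2 ^+ n * (expR (n%:R * (H beta p y - sup_H beta p `[-1, 1] - e)) *
   expR (n%:R * sup_H beta p `[-1, 1])) * (n.+1%:R * n.+1%:R)); last by ring.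
  by rewrite ler_pM2l ?mulr_gt0 ?exprn_gt0 ?expR_gt0// ler_pM.
rewrite /a -!expRD -mulrA ler_pM2l ?exprn_gt0// -expRD ler_expR -!mulrDr.
by rewrite ler_pM2l ?ltr0n//; lra.
Unshelve. all: by end_near. Qed.

End LD.

(** * Exponential rates and the Bahadur slope *)

Section Rate.
Context {R : realType}.
Implicit Types (p n k : nat) (beta x y r e s lam : R).

(** The shift by [beta0] and the factor [sqrt n] are common to both samples and cancel; at [n = 0]
    that factor would vanish. *)
Lemma p_valueE p (est : @estimator R) beta0 n (X : config n) : (0 < n)%N ->
  p_value p est beta0 X = cw_prob p beta0 (fun Y => est n X < est n Y)%E.
Proof.
move=> n0; rewrite /p_value /test_cdf cw_probC; apply: eq_bigl => Y /=.
rewrite -ltNge /test_stat lte_pmul2l// ?lte_fin ?sqrtr_gt0 ?ltr0n//.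
by rewrite lteD2rE.
Qed.

(** The event of [is_bahadur_slope] at [c = 2 * lam], kept in the same syntactic form. *)
Definition slope_deviation p (est : @estimator R) beta0 lam e n : pred (config n) :=
  fun X => (e%:E < `| n%:R^-1%:E * lne (p_value p est beta0 X)%:E
                 - (- (2^-1 * (2 * lam)))%:E |)%E.

Lemma slope_deviationPn p (est : @estimator R) beta0 lam e n (X : config n) : (0 < n)%N ->
  (~~ slope_deviation p est beta0 lam e X) =
  (expR (- (n%:R * (lam + e))) <= p_value p est beta0 X <= expR (- (n%:R * (lam - e)))).
Proof.
move=> n0; rewrite /slope_deviation -leNgt.
have nR : 0 < n%:R :> R by rewrite ltr0n.
set L := p_value _ _ _ _; have [L0|L0] := leP L 0.
  (* A vanishing p-value has logarithm [-oo] and so always counts as a deviation. *)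
  rewrite [RHS](_ : _ = false); last first.
    apply/negbTE/negP => /andP[h _].
    by have := le_trans h L0; rewrite leNgt expR_gt0.
  by rewrite le0_lneNy ?lee_fin// gt0_muleNy ?lte_fin ?invr_gt0.
rewrite lne_EFin// -EFinM -EFinB abse_EFin lee_fin mulrA mulVf// mul1r opprK.
rewrite -[in RHS](lnK (_ : L \is Num.pos)) ?posrE// !ler_expR ler_norml.
rewrite -(ler_pM2l nR) -[in X in _ && X](ler_pM2l nR) mulrDr mulrA divff ?mul1r ?lt0r_neq0//.
apply/andP/andP => -[h1 h2]; split; lra.
Qed.

(** Stronger than convergence in probability: the deviation probabilities are summable over [n], as
    the almost sure statement requires. *)
Definition exponential_rate p (est : @estimator R) beta0 beta lam :=
  forall e, 0 < e -> exists2 kappa : R, 0 < kappa & \forall n \near \oo,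
    cw_prob p beta (@slope_deviation p est beta0 lam e n) <= expR (- (n%:R * kappa)).

(** Reduces the rate to properties of functions on [-1,1]. [U] holds the means that are typical
    under [beta]. For a sample in [U] the p-value is the null probability of an event that contains
    all means near [y], where the null [H] is almost [s], and that lies inside [H <= s + e]. *)
Lemma exponential_rate_of_separation p (est : @estimator R) beta0 beta s :
  (forall e, 0 < e -> exists y r kappa (U : set R),
    [/\ [/\ y \in `[-1, 1], 0 < r, 0 < kappa & s - e <= H beta0 p y],
       forall x, x \in `[-1, 1] -> U x \/ H beta p x <= sup_H beta p `[-1, 1] - kappa &
       \forall n \near \oo, forall X Y : config n, U (sample_mean X) ->
         (`|sample_mean Y - y| < r -> (est n X < est n Y)%E) /\
         ((est n X < est n Y)%E -> H beta0 p (sample_mean Y) <= s + e)]) ->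
  exponential_rate p est beta0 beta (sup_H beta0 p `[-1, 1] - s).
Proof.
move=> sep e e0; have e2 : 0 < e / 2 by rewrite divr_gt0.
have [y [r [kappa [U [[y1 r0 kappa0 sy] HU sepn]]]]] := sep _ e2.
have k2 : 0 < kappa / 2 by rewrite divr_gt0.
exists (kappa / 2) => //; near=> n.
have n0 : (0 < n)%N by near: n; exact: nbhs_infty_gt.
have up : forall (A : pred (config n)) s,
    (forall X, A X -> H beta p (sample_mean X) <= s) ->
    cw_prob p beta A <= expR (n%:R * (s - sup_H beta p `[-1, 1] + kappa / 2)).
  by near: n; exact: cw_prob_upper.
have up0 : forall (A : pred (config n)) s,
    (forall X, A X -> H beta0 p (sample_mean X) <= s) ->
    cw_prob p beta0 A <= expR (n%:R * (s - sup_H beta0 p `[-1, 1] + e / 2)).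
  by near: n; exact: cw_prob_upper.
have lo0 : forall A : pred (config n),
    (forall X, `|sample_mean X - y| < r -> A X) ->
    expR (n%:R * (H beta0 p y - sup_H beta0 p `[-1, 1] - e / 2)) <= cw_prob p beta0 A.
  by near: n; exact: cw_prob_lower.
have sep1 : forall X Y : config n, U (sample_mean X) ->
         (`|sample_mean Y - y| < r -> (est n X < est n Y)%E) /\
         ((est n X < est n Y)%E -> H beta0 p (sample_mean Y) <= s + e / 2).
  by near: n; exact: sepn.
rewrite (_ : - (n%:R * (kappa / 2)) =
  n%:R * (sup_H beta p `[-1, 1] - kappa - sup_H beta p `[-1, 1] + kappa / 2)); last by field.
apply: up => X; apply: contraTT; rewrite -ltNge => HX.
have UX : U (sample_mean X).
  have Xin : sample_mean X \in `[-1 : R, 1].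
    by rewrite sample_meanE// lattice_mean_itv// ups_le.
  by have [//|] := HU _ Xin; rewrite leNgt HX.
rewrite slope_deviationPn// p_valueE//; apply/andP; split.
  apply: le_trans (lo0 _ _); last by move=> Y; apply: (sep1 X Y UX).1.
  by rewrite ler_expR -mulrN ler_pM2l ?ltr0n//; lra.
apply: le_trans (up0 _ (s + e / 2) _) _; last first.
  by rewrite ler_expR -mulrN ler_pM2l ?ltr0n//; lra.
by move=> Y; apply: (sep1 X Y UX).2.
Unshelve. all: by end_near. Qed.

Lemma cvg_expRN kappa : 0 < kappa -> expR (- (n%:R * kappa)) @[n --> \oo] --> (0 : R).
Proof.
move=> k0; rewrite (_ : (fun n : nat => _) = geometric 1 (expR (- kappa))).
  by apply: cvg_geometric; rewrite ger0_norm ?expR_ge0// expR_lt1 oppr_lt0.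
by apply/funext => n; rewrite /= mul1r -expRM_natl mulrN.
Qed.

Lemma exponential_rate_slope p (est : @estimator R) beta0 beta lam :
  exponential_rate p est beta0 beta lam ->
  is_bahadur_slope p est beta0 beta (2 * lam).
Proof.
move=> rate e e0; have [kappa k0 dev] := rate e e0.
apply: (squeeze_cvgr _ (@cvg_cst _ _ _ _ _) (cvg_expRN k0)).
by near=> n; rewrite cw_prob_ge0/=; near: n.
Unshelve. all: by end_near. Qed.

End Rate.

(** * Sample sizes *)

Section SampleSize.
Context {R : realType}.
Implicit Types (p n k : nat) (beta x y r e s lam delta kappa : R).

Lemma cvg_EFin1_of_bounds (T : Type) (F : set_system T) (f : T -> \bar R) :
  Filter F ->
  (forall e, 0 < e -> \forall t \near F, ((1 - e)%:E <= f t <= (1 + e)%:E)%E) ->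
  f t @[t --> F] --> 1%E.
Proof.
move=> FF bnd; have fin : \forall t \near F, f t \is a fin_num.
  have := bnd 1 ltr01; apply: filterS => t /andP[h1 h2].
  by rewrite fin_numE; apply/andP; split; apply/eqP => ft; rewrite ft in h1 h2.
apply: cvg_EFin => //; apply/cvgrPdist_le => e e0.
near=> t.
have ft : f t \is a fin_num by near: t.
have : ((1 - e)%:E <= f t <= (1 + e)%:E)%E by near: t; exact: bnd.
rewrite -(fineK ft) !lee_fin /= => /andP[h1 h2].
by rewrite ler_norml; apply/andP; split; lra.
Unshelve. all: by end_near. Qed.

(** For an admissible [N], [L n <= delta] at [n = maxn n0 N] forces this [n] above the bound; [n0]
    lies below it, so [N] lies above. *)
Lemma min_sample_size_ge (L : nat -> R) delta n0 lam :
  0 < lam -> (forall n, (n0 <= n)%N -> expR (- (n%:R * lam)) <= L n) ->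
  0 < delta -> n0%:R < - ln delta / lam ->
  ((- ln delta / lam)%:E <= min_sample_size L delta)%E.
Proof.
move=> lam0 HL d0 n0d; apply: le_ereal_inf_tmp => _ [N [N1 supN] <-].
rewrite lee_fin.
have LN n : (maxn n0 N <= n)%N -> - ln delta / lam <= n%:R.
  rewrite geq_max => /andP[n0n Nn].
  have : L n <= delta.
    rewrite -lee_fin; apply: le_trans supN; apply: ereal_sup_ubound.
    by exists n.
  move=> /(le_trans (HL _ n0n)); rewrite -[X in _ <= X]lnK ?posrE// ler_expR.
  by rewrite ler_pdivrMr//; lra.
have := LN _ (leqnn _); rewrite natr_max le_max => /orP[|//].
by rewrite leNgt n0d.
Qed.

(** The truncation of [M] is admissible, and the 1 subtracted from [M] absorbs the rounding. *)
Lemma min_sample_size_le (L : nat -> R) delta n0 lam M :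
  0 < lam -> (forall n, (n0 <= n)%N -> L n <= expR (- (n%:R * lam))) ->
  0 < delta -> (n0%:R <= M) -> 1 <= M -> - ln delta / lam <= M - 1 ->
  (min_sample_size L delta <= M%:E)%E.
Proof.
move=> lam0 HL d0 n0M M1 dM; have M0 : 0 <= M by lra.
have /andP[NM MN] := truncn_itv M0; set N := Num.truncn M in NM MN.
apply: (@le_trans _ _ (N%:R)%:E); last by rewrite lee_fin.
apply: ereal_inf_lbound; exists N => //; split.
  by rewrite truncn_ge_nat.
apply: ge_ereal_sup => _ [n /= Nn <-]; rewrite lee_fin.
have n0n : (n0 <= n)%N by apply: leq_trans Nn; rewrite truncn_ge_nat.
apply: le_trans (HL _ n0n) _; rewrite -[leRHS]lnK ?posrE// ler_expR.
have : M - 1 <= n%:R.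
  have : N%:R <= n%:R :> R by rewrite ler_nat.
  by move: MN; rewrite -natr1; lra.
by move: dM; rewrite ler_pdivrMr// => dM Mn; nra.
Qed.

Lemma min_sample_size_equiv (L : nat -> R) lam : 0 < lam ->
  (forall e, 0 < e -> \forall n \near \oo,
    expR (- (n%:R * (lam + e))) <= L n <= expR (- (n%:R * (lam - e)))) ->
  (min_sample_size L delta * ((ln delta / - lam)^-1)%:E)%E @[delta --> 0^'+] --> 1%E.
Proof.
move=> lam0 HL; apply: cvg_EFin1_of_bounds => e e0.
have [n1 _ Hlo] := HL (lam * e) (mulr_gt0 lam0 e0).
(* Chosen so that [1 - f = 1 / (1 + e / 2)]: the upper bound costs a factor [1 + e / 2], and the
   other half of [e] is left for the rounding. *)
pose f := (e / 2) / (1 + e / 2).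
have e2 : 0 < 1 + e / 2 by lra.
have f0 : 0 < f by rewrite /f; apply: divr_gt0; lra.
have [n2 _ Hup] := HL (lam * f) (mulr_gt0 lam0 f0).
have ff : lam - lam * f = lam / (1 + e / 2).
  by rewrite /f; field; rewrite lt0r_neq0//=; lra.
near=> delta.
have d0 : 0 < delta by near: delta; exact: nbhs_right_gt.
pose A := ln delta / - lam.
have AE : A = - ln delta / lam by rewrite /A invrN mulrN mulNr.
(* The term in [n1] serves the lower bound and [n2] the upper one, while [2 / e] makes [A * (e / 2)]
   at least 1. *)
have AM : 1 + (1 + e) * n1%:R + n2%:R + 2 / e <= A.
  rewrite AE ler_pdivlMr// lerNr; near: delta.
  exact: (cvgrNy_le (@lnNy R)).
have nn1 : 0 <= n1%:R :> R by [].
have nn2 : 0 <= n2%:R :> R by [].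
have en1 : 0 <= (1 + e) * n1%:R by rewrite mulr_ge0//; lra.
have e20 : 0 < 2 / e by rewrite divr_gt0.
have A0 : 0 < A by lra.
rewrite lee_pdivlMr// lee_pdivrMr// -/A -!EFinM; apply/andP; split.
  apply: (@le_trans _ _ (A / (1 + e))%:E).
    rewrite lee_fin ler_pdivlMr; last by lra.
    by rewrite mulrAC ler_piMl ?(ltW A0)//; nra.
  have -> : A / (1 + e) = - ln delta / (lam + lam * e).
    by rewrite AE; field; rewrite !lt0r_neq0//=; nra.
  apply: (@min_sample_size_ge L delta n1) => //.
  - by apply: addr_gt0 => //; exact: mulr_gt0.
  - by move=> n /Hlo /andP[].
  have -> : - ln delta / (lam + lam * e) = A / (1 + e).
    by rewrite AE; field; rewrite !lt0r_neq0//=; nra.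
  by rewrite ltr_pdivlMr; lra.
apply: (@min_sample_size_le L delta n2 (lam - lam * f)) => //.
- by rewrite ff divr_gt0.
- by move=> n /Hup /andP[].
- by nra.
- by nra.
rewrite ff (_ : - ln delta / (lam / (1 + e / 2)) = A * (1 + e / 2)); last first.
  by rewrite AE; field; rewrite !lt0r_neq0//=; lra.
have : 1 <= A * (e / 2).
  have {1}<- : (2 / e) * (e / 2) = 1 by field; rewrite lt0r_neq0.
  by rewrite ler_pM2r ?divr_gt0//; lra.
by lra.
Unshelve. all: by end_near. Qed.

Lemma cw_samples_measurable p beta d (Omega : measurableType d)
    (P : probability Omega R) (X : forall n, Omega -> config n) n
    (A : pred (config n)) : cw_samples p beta P X -> (0 < n)%N ->
  measurable [set w | A (X n w)] /\
  P [set w | A (X n w)] = (cw_prob p beta A)%:E.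
Proof.
move=> HX n0.
have -> : [set w | A (X n w)] = \bigcup_(x in [set` A]) (X n @^-1` [set x]).
  by apply/seteqP; split => [w Aw|w [x Ax] /= ->//]; exists (X n w).
split.
  apply: fin_bigcup_measurable; first exact: finite_finset.
  by move=> x _; have [] := HX n n0 x.
rewrite measure_fin_bigcup//.
- rewrite (_ : (\sum_(x \in [set` A]) _ = \sum_(x <- enum A) P (X n @^-1` [set x]))%E).
    rewrite big_enum/= -sumEFin.
    by apply: eq_bigr => x _; have [] := HX n n0 x.
  rewrite [RHS](fsbig_seq _ _ (enum_uniq A)); apply: eq_fsbigl.
  by apply/seteqP; split => x /=; rewrite mem_enum.
- by move=> x y _ _ [w [/= <- <-]].
- by move=> x _; have [] := HX n n0 x.
Qed.

(* First Borel-Cantelli lemma: no joint law of the samples is involved. *)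
Lemma cw_samples_eventually p beta d (Omega : measurableType d)
    (P : probability Omega R) (X : forall n, Omega -> config n)
    (A : forall n, pred (config n)) kappa :
  cw_samples p beta P X -> 0 < kappa ->
  (\forall n \near \oo, cw_prob p beta (A n) <= expR (- (n%:R * kappa))) ->
  {ae P, forall w, \forall n \near \oo, ~~ A n (X n w)}.
Proof.
move=> HX k0 [n0 _ HA].
(* Emptying the early events also removes [n = 0], where [cw_samples] says nothing. *)
pose F n := if (n0 < n)%N then [set w | A n (X n w)] else set0.
have mF n : measurable (F n).
  rewrite /F; case: ifP => // n0n.
  by have [] := cw_samples_measurable (A n) HX (leq_ltn_trans (leq0n _) n0n).
have PF n : (P (F n) <= (expR (- (n%:R * kappa)))%:E)%E.
  rewrite /F; case: ifP => n0n; last by rewrite measure0 lee_fin expR_ge0.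
  have [_ ->] := cw_samples_measurable (A n) HX (leq_ltn_trans (leq0n _) n0n).
  by rewrite lee_fin; apply: HA; rewrite /= ltnW.
have z1 : `|expR (- kappa)| < 1.
  by rewrite ger0_norm ?expR_ge0// expR_lt1 oppr_lt0.
have sumF : (\sum_(0 <= n <oo) P (F n) < +oo)%E.
  apply: (@le_lt_trans _ _ (\sum_(0 <= n <oo) (geometric 1 (expR (- kappa)) n)%:E)%E).
    apply: lee_nneseries => // n _.
    by rewrite /geometric/= mul1r -expRM_natl mulrN.
  have cv := @cvg_geometric_series R 1 _ z1.
  rewrite (_ : (\sum_(0 <= n <oo) _)%E = (1 / (1 - expR (- kappa)))%:E) ?ltry//.
  apply/cvg_lim => //; apply: cvg_EFin; first by near=> n; rewrite sumEFin.
  by apply: cvg_trans cv; apply: near_eq_cvg; near=> n; rewrite /= sumEFin.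
exists (lim_sup_set F); split.
- by apply: bigcap_measurable => // k _; apply: bigcup_measurable.
- exact: lim_sup_set_cvg0.
move=> w /= nw m _; apply: contrapT => none; apply: nw.
exists (maxn m n0.+1) => // n /=; rewrite geq_max => /andP[mn n0n].
apply/negP => An; apply: none; exists n => //.
by rewrite /F n0n.
Unshelve. all: by end_near. Qed.

Lemma exponential_rate_sample_size p (est : @estimator R) beta0 beta lam
    d (Omega : measurableType d) (P : probability Omega R)
    (X : forall n, Omega -> config n) :
  0 < lam -> exponential_rate p est beta0 beta lam -> cw_samples p beta P X ->
  {ae P, forall w, sample_size_equiv p est beta0 (fun n => X n w)
    (fun delta => ln delta / - lam)}.
Proof.
move=> lam0 rate HX.
(* Countably many tolerances keep the exceptional set negligible, and every [e] exceeds one of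
   them. *)
have : {ae P, forall w, forall k : nat, \forall n \near \oo,
    ~~ slope_deviation p est beta0 lam k.+1%:R^-1 (X n w)}.
  apply: ae_foralln => k.
  have k0 : 0 < k.+1%:R^-1 :> R by rewrite invr_gt0.
  have [kappa kappa0 dev] := rate _ k0.
  exact: (cw_samples_eventually HX kappa0 dev).
apply: filterS => w dev; apply: min_sample_size_equiv => // e e0.
near \oo => k; have := dev k; apply: filter_app; near=> n.
have n0 : (0 < n)%N by near: n; exact: nbhs_infty_gt.
rewrite slope_deviationPn// => /andP[h1 h2].
have ke : k.+1%:R^-1 <= e.
  near: k; have := near_infty_natSinv_lt (PosNum e0).
  by apply: filterS => j /ltW.
apply/andP; split; [apply: le_trans h1|apply: le_trans h2 _].
  by rewrite ler_expR lerN2 ler_wpM2l// lerD2l.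
by rewrite ler_expR lerN2 ler_wpM2l// lerD2l lerN2.
Unshelve. all: by end_near. Qed.

End SampleSize.

(** * Derivatives *)

Section Calculus.
Context {R : realType}.
Implicit Types (p n k q : nat) (beta x y r e s kappa : R).

Lemma mvt_strict (f df : R -> R) (a b : R) : a < b ->
  (forall x, a <= x <= b -> is_derive x 1 f (df x)) ->
  exists c, a < c < b /\ f b - f a = df c * (b - a).
Proof.
move=> ab Hf; have [||c] := MVT ab (df := df) (f := f).
- by move=> x /[!in_itv]/= /andP[ax xb]; apply: Hf; rewrite !ltW.
- apply: derivable_within_continuous => x /[!in_itv]/= xab.
  by have [] := Hf _ xab.
by rewrite in_itv/= => cab E; exists c.
Qed.

Lemma is_derive_pow n x : is_derive x 1 (fun t : R => t ^+ n) (n%:R * x ^+ n.-1).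
Proof.
apply: DeriveDef; first exact: exprn_derivable.
by rewrite exp_derive /GRing.scale/= mulr1.
Qed.

Lemma is_derive_ln1D x : -1 < x -> is_derive x 1 (fun t => ln (1 + t)) (1 + x)^-1.
Proof.
move=> x1; have d1 : is_derive x 1 (fun t : R => 1 + t) 1.
  by have := is_deriveD (is_derive_cst (1 : R) x 1) (is_derive_id x 1); rewrite add0r.
have := is_derive1_comp (is_derive1_ln _) d1.
by rewrite mulr1; apply; lra.
Qed.

Lemma is_derive_ln1B x : x < 1 -> is_derive x 1 (fun t => ln (1 - t)) (- (1 - x)^-1).
Proof.
move=> x1; have d1 : is_derive x 1 (fun t : R => 1 - t) (- 1).
  by have := is_deriveB (is_derive_cst (1 : R) x 1) (is_derive_id x 1); rewrite sub0r.
have := is_derive1_comp (is_derive1_ln _) d1.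
by rewrite mulrN1; apply; lra.
Qed.

Definition atanh x : R := 2^-1 * (ln (1 + x) - ln (1 - x)).

Lemma is_derive_atanh x : -1 < x < 1 -> is_derive x 1 atanh (1 - x ^+ 2)^-1.
Proof.
move=> /andP[x1 x2].
have d1 := is_derive_ln1D x1; have d2 := is_derive_ln1B x2.
have := is_deriveZ (2^-1 : R) (is_deriveB d1 d2).
move=> /is_derive_eq; apply.
rewrite /GRing.scale/=; field.
by rewrite !lt0r_neq0//=; nra.
Qed.

Lemma is_derive_xlnx x : 0 < x -> is_derive x 1 (fun t : R => t * ln t) (ln x + 1).
Proof.
move=> x0; have d1 := is_derive1_ln x0.
have := is_deriveM (is_derive_id x (1 : R)) d1.
move=> /is_derive_eq; apply.
by rewrite /GRing.scale/= mulfV ?lt0r_neq0// mulr1 addrC.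
Qed.

Lemma is_derive_H beta p x : -1 < x < 1 ->
  is_derive x 1 (H beta p) (beta * p%:R * x ^+ p.-1 - atanh x).
Proof.
move=> /andP[x1 x2].
have d1 : is_derive x 1 (fun t : R => 1 + t) 1.
  by have := is_deriveD (is_derive_cst (1 : R) x 1) (is_derive_id x 1); rewrite add0r.
have d2 : is_derive x 1 (fun t : R => 1 - t) (- 1).
  by have := is_deriveB (is_derive_cst (1 : R) x 1) (is_derive_id x 1); rewrite sub0r.
have p1 : 0 < 1 + x by lra.
have p2 : 0 < 1 - x by lra.
have e1 := @is_derive1_comp R (fun t => t * ln t) (fun t => 1 + t) x _ _ (is_derive_xlnx p1) d1.
have e2 := @is_derive1_comp R (fun t => t * ln t) (fun t => 1 - t) x _ _ (is_derive_xlnx p2) d2.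
have := is_deriveB (is_deriveZ beta (is_derive_pow p x)) (is_deriveZ (2^-1 : R) (is_deriveD e1 e2)).
move=> /is_derive_eq; apply.
by rewrite /atanh /GRing.scale/=; field.
Qed.

End Calculus.

(** * Bounds on [atanh] and the shape of [atanh x / x ^ q] *)

Section Calculus2.
Context {R : realType}.
Implicit Types (p n k q : nat) (beta x y r e s kappa : R).

Lemma atanh0 : atanh (0 : R) = 0.
Proof. by rewrite /atanh addr0 subr0 subrr mulr0. Qed.

Lemma atanhN x : atanh (- x) = - atanh x.
Proof. by rewrite /atanh opprK -mulrN opprB. Qed.

Lemma atanh_mean_value x : 0 < x < 1 ->
  exists2 c, 0 < c < x & atanh x = (1 - c ^+ 2)^-1 * x.
Proof.
move=> /andP[x0 x1].
have [|c [c0x E]] := @mvt_strict R atanh (fun t => (1 - t ^+ 2)^-1) 0 x x0.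
  by move=> t /andP[t0 tx]; apply: is_derive_atanh; apply/andP; split; lra.
by exists c => //; move: E; rewrite atanh0 !subr0.
Qed.

Lemma atanh_gt x : 0 < x < 1 -> x < atanh x.
Proof.
move=> x01; have [c /andP[c0 cx] ->] := atanh_mean_value x01.
move: x01 => /andP[x0 x1].
by rewrite ltr_pMl// invf_gt1; nra.
Qed.

Lemma atanh_le x : 0 < x < 1 -> atanh x <= x / (1 - x ^+ 2).
Proof.
move=> x01; have [c /andP[c0 cx] ->] := atanh_mean_value x01.
move: x01 => /andP[x0 x1].
by rewrite mulrC ler_pM2l// lef_pV2 ?posrE; nra.
Qed.

Lemma atanh_gt0 x : 0 < x < 1 -> 0 < atanh x.
Proof. by move=> x01; apply: lt_trans (atanh_gt x01); case/andP: x01. Qed.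

(** With [q = p - 1] this is [p] times [eta p] on (0,1), and the critical points of [H beta p] there
    are the points where it equals [beta * p]. *)
Definition atanh_over_pow q x : R := x^-1 ^+ q * atanh x.

(** The derivative of [atanh_over_pow q] up to a positive factor; it vanishes at 0. *)
Let slope_sign q x : R := x / (1 - x ^+ 2) - q%:R * atanh x.

Lemma is_derive_atanh_over_pow q x : 0 < x < 1 ->
  is_derive x 1 (atanh_over_pow q) (x^-1 ^+ q.+1 * slope_sign q x).
Proof.
move=> /andP[x0 x1].
have d1 : is_derive x 1 atanh (1 - x ^+ 2)^-1.
  by apply: is_derive_atanh; apply/andP; split; lra.
have xn0 : x != 0 by rewrite lt0r_neq0.
have d2 := @is_deriveV R id x 1 1 xn0 (is_derive_id x 1).
have d3 := @is_derive1_comp R (fun t => t ^+ q) (fun t => t^-1) x _ _ (is_derive_pow q _) d2.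
have := is_deriveM d3 d1; move=> /is_derive_eq; apply.
rewrite /slope_sign /GRing.scale/=.
have y0 : 1 - x ^+ 2 != 0 by rewrite lt0r_neq0//; nra.
case: q {d3} => [|q].
  by rewrite expr0 expr1 !mul0r mulr0 addr0 subr0 mul1r mulrA mulVf ?mul1r.
rewrite /= !exprS; move: (x^-1 ^+ q) => z; field.
by rewrite y0 xn0.
Qed.

Lemma is_derive_slope_sign q x : 0 <= x < 1 ->
  is_derive x 1 (slope_sign q)
    ((q.+1%:R * x ^+ 2 - (q%:R - 1)) / (1 - x ^+ 2) ^+ 2).
Proof.
move=> /andP[x0 x1].
have d1 : is_derive x 1 atanh (1 - x ^+ 2)^-1.
  by apply: is_derive_atanh; apply/andP; split; lra.
have y0 : 1 - x ^+ 2 != 0 by rewrite lt0r_neq0//; nra.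
have d0 := is_deriveB (is_derive_cst (1 : R) x 1) (is_derive_pow 2 x).
have d2 := @is_deriveV R (fun t => 1 - t ^+ 2) x _ 1 y0 d0.
have := is_deriveB (is_deriveM (is_derive_id x 1) d2) (is_deriveZ q%:R d1).
move=> /is_derive_eq; apply.
rewrite /GRing.scale/= -natr1; field.
by rewrite y0.
Qed.

(* A critical point of [atanh x / x ^ q] on (0,1) is a zero of [slope_sign q],
   whose derivative changes sign at most once, from negative to positive. *)
Lemma atanh_over_pow_quasiconvex q a b c : 0 < a -> a < b -> b < c -> c < 1 ->
  atanh_over_pow q b < Num.max (atanh_over_pow q a) (atanh_over_pow q c).
Proof.
move=> a0 ab bc c1; rewrite ltNge ge_max; apply/negP => /andP[ga gc].
have dg x : 0 < x -> x < 1 -> is_derive x 1 (atanh_over_pow q) (x^-1 ^+ q.+1 * slope_sign q x).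
  by move=> x0 x1; apply: is_derive_atanh_over_pow; rewrite x0.
have ds x : 0 <= x -> x < 1 -> is_derive x 1 (slope_sign q)
    ((q.+1%:R * x ^+ 2 - (q%:R - 1)) / (1 - x ^+ 2) ^+ 2).
  by move=> x0 x1; apply: is_derive_slope_sign; rewrite x0.
(* If [b] were at least as high as [a] and [c], there would be [u < b < v] with [slope_sign]
   nonnegative at [u] and nonpositive at [v]. *)
have [|u [/andP[au ub] gu]] := mvt_strict ab (f := atanh_over_pow q) (df := fun x => x^-1 ^+ q.+1 * slope_sign q x).
  by move=> x /andP[ax xb]; apply: dg; lra.
have [|v [/andP[bv vc] gv]] := mvt_strict bc (f := atanh_over_pow q) (df := fun x => x^-1 ^+ q.+1 * slope_sign q x).
  by move=> x /andP[ax xb]; apply: dg; lra.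
have pw x : 0 < x -> 0 < x^-1 ^+ q.+1 by move=> x0; rewrite exprn_gt0 ?invr_gt0.
have u0 : 0 < u by lra.
have v0 : 0 < v by lra.
have su : 0 <= slope_sign q u.
  have : 0 <= u^-1 ^+ q.+1 * slope_sign q u * (b - a) by rewrite -gu subr_ge0.
  by rewrite pmulr_lge0 ?subr_gt0// pmulr_rge0// pw.
have sv : slope_sign q v <= 0.
  have : v^-1 ^+ q.+1 * slope_sign q v * (c - b) <= 0 by rewrite -gv subr_le0.
  by rewrite pmulr_lle0 ?subr_gt0// pmulr_rle0// pw.
(* Then [slope_sign], starting from 0 at 0, has a nonnegative derivative at some [w < u] and a
   nonpositive one at some [z > u], whereas the numerator of this derivative is strictly
   increasing. *)
have [|w [/andP[w0 wu] sw]] := mvt_strict u0 (f := slope_sign q) (df := fun x =>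
   ((q.+1%:R * x ^+ 2 - (q%:R - 1)) / (1 - x ^+ 2) ^+ 2)).
  by move=> x /andP[ax xb]; apply: ds; lra.
have uv : u < v by lra.
have [|z [/andP[uz zv] sz]] := mvt_strict uv (f := slope_sign q) (df := fun x =>
   ((q.+1%:R * x ^+ 2 - (q%:R - 1)) / (1 - x ^+ 2) ^+ 2)).
  by move=> x /andP[ax xb]; apply: ds; lra.
have den x : 0 < x -> x < 1 -> 0 < ((1 - x ^+ 2) ^+ 2)^-1.
  by move=> x0 x1; rewrite invr_gt0 exprn_gt0//; nra.
have w1 : 0 <= q.+1%:R * w ^+ 2 - (q%:R - 1).
  have : 0 <= slope_sign q u - slope_sign q 0.
    by rewrite {2}/slope_sign atanh0 mul0r mulr0 !subr0.
  by rewrite sw pmulr_lge0 ?subr_gt0// pmulr_lge0// den//; lra.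
have z1 : q.+1%:R * z ^+ 2 - (q%:R - 1) <= 0.
  have : slope_sign q v - slope_sign q u <= 0 by lra.
  by rewrite sz pmulr_lle0 ?subr_gt0// pmulr_lle0// den//; lra.
have : q.+1%:R * w ^+ 2 < q.+1%:R * z ^+ 2 :> R.
  by rewrite ltr_pM2l ?ltr0n//; nra.
by lra.
Qed.

Lemma continuous_atanh_over_pow q x : 0 < x < 1 ->
  atanh_over_pow q y @[y --> x] --> atanh_over_pow q x.
Proof.
move=> x01; apply: differentiable_continuous; apply/derivable1_diffP.
by have [] := is_derive_atanh_over_pow q x01.
Qed.

End Calculus2.

(** * Maximizers of [H] *)

Section Maximizers.
Context {R : realType}.
Implicit Types (p n k q : nat) (beta x y u v r e s kappa : R).

Lemma xlnx_ge x : 0 <= x -> x - 1 <= x * ln x.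
Proof.
rewrite le_eqVlt => /predU1P[<-|x0]; first by rewrite mul0r; lra.
have : ln (1 + (x^-1 - 1)) <= x^-1 - 1.
  by apply: le_ln1Dx; rewrite ltrBrDr addNr invr_gt0.
rewrite addrCA subrr addr0 lnV ?posrE// => h.
have : x * - ln x <= x * (x^-1 - 1) by rewrite ler_pM2l.
by rewrite mulrBr divff ?lt0r_neq0//; lra.
Qed.

(** Adding [t - 1 <= t ln t] at [t = 1 + x] and [t = 1 - x] shows that the subtracted entropy term
    is nonnegative. *)
Lemma H_le beta p x : x \in `[-1, 1] -> H beta p x <= beta * x ^+ p.
Proof.
rewrite in_itv/= => /andP[x0 x1].
have h1 := @xlnx_ge (1 + x) ltac:(lra).
have h2 := @xlnx_ge (1 - x) ltac:(lra).
by rewrite /H; lra.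
Qed.

Lemma H_at0 beta p : (0 < p)%N -> H beta p 0 = 0.
Proof.
by move=> p0; rewrite /H addr0 subr0 ln1 expr0n gtn_eqF// !mulr0 addr0 mulr0 subrr.
Qed.

Lemma HN beta p x : H beta p (- x) = H beta p x - (x ^+ p - (- x) ^+ p) * beta.
Proof. by rewrite /H opprK; lra. Qed.

Lemma HN_even beta p x : ~~ odd p -> H beta p (- x) = H beta p x.
Proof. by move=> /negbTE pe; rewrite HN exprNn -signr_odd pe mul1r subrr mul0r subr0. Qed.

Lemma beta_star_lt p beta : (0 < p)%N -> beta_star p < beta ->
  0 < beta /\ 0 < sup_H beta p `[-1, 1].
Proof.
move=> p0 hb; set B := [set b : R | 0 <= b /\ sup_H b p `[-1, 1] = 0].
have z01 : (0 : R) \in `[-1, 1] by rewrite in_itv/=; apply/andP; split; lra.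
have B0 : B 0.
  split => //; apply/eqP; rewrite eq_le; apply/andP; split.
    have [y y1 <-] := sup_H_attained (0 : R) p.
    by have := H_le (0 : R) p y1; rewrite mul0r.
  by have := H_le_sup 0 p z01; rewrite H_at0.
(* Boundedness makes [sup] a genuine upper bound. It comes from [H b p 1 = b - ln 2], which cannot
   exceed 0 on [B]. *)
have Bub : has_ubound B.
  exists (ln 2) => b [b0 Sb].
  have one1 : (1 : R) \in `[-1, 1] by rewrite in_itv/=; apply/andP; split; lra.
  have := H_le_sup b p one1.
  by rewrite Sb /H subrr mul0r addr0 expr1n mulr1 (_ : 1 + 1 = 2 :> R)//; lra.
have bpos : 0 < beta.
  by apply: le_lt_trans hb; exact: ub_le_sup.
split => //; have := H_le_sup beta p z01; rewrite H_at0// le_eqVlt => /predU1P[/esym Sb|//].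
move: hb; rewrite ltNge => /negP[].
by apply: ub_le_sup => //; split => //; exact: ltW.
Qed.

Lemma maximizer_stationary beta p y : 0 < y < 1 ->
  H beta p y = sup_H beta p `[-1, 1] ->
  atanh_over_pow p.-1 y = beta * p%:R.
Proof.
move=> /andP[y0 y1] ymax.
have d : is_derive y 1 (H beta p) 0.
  apply: (@derive1_at_max _ _ (-1) 1); [by lra| | |].
  - move=> t; rewrite in_itv/= => t01.
    by have [] := is_derive_H beta p t01.
  - by rewrite in_itv/=; apply/andP; split; lra.
  - move=> t; rewrite in_itv/= => /andP[t0 t1]; rewrite ymax; apply: H_le_sup.
    by rewrite in_itv/= !ltW.
have y01 : -1 < y < 1 by apply/andP; split; lra.
have := @derive_val _ _ _ _ _ _ _ (is_derive_H beta p y01).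
rewrite (@derive_val _ _ _ _ _ _ _ d) => E.
rewrite /atanh_over_pow (_ : atanh y = beta * p%:R * y ^+ p.-1); last by lra.
by rewrite exprVn mulrC mulfK// expf_neq0// lt0r_neq0.
Qed.

(** The derivative of [H] tends to [-oo] at 1 because [atanh] tends to [+oo], so [H] decreases just
    before 1. *)
Lemma H1_lt_sup beta p : H beta p 1 < sup_H beta p `[-1, 1].
Proof.
(* For [c > 1 - expR (- M)] this gives [atanh c > M / 2], which exceeds the absolute value of
   [beta * p]. *)
pose M := 2 * `|beta * p%:R| + 1; pose x := 1 - expR (- M).
have M0 : 0 < M by rewrite ltr_wpDl// mulr_ge0.
have E0 := expR_gt0 (- M).
have E1 : expR (- M) < 1 by rewrite expR_lt1 oppr_lt0.
have x01 : x < 1 by rewrite /x; lra.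
have [||c] := @MVT R (H beta p) (fun t => beta * p%:R * t ^+ p.-1 - atanh t) x 1 x01.
- move=> t; rewrite in_itv/= => /andP[xt t1]; apply: is_derive_H.
  by apply/andP; split => //; move: xt; rewrite /x; lra.
- exact/continuous_subspaceT/continuous_H.
rewrite in_itv/= => /andP[xc c1] Hc.
have xin : x \in `[-1, 1] by rewrite in_itv/=; apply/andP; split; rewrite /x; lra.
apply: lt_le_trans (H_le_sup beta p xin); rewrite -subr_lt0 Hc.
rewrite pmulr_llt0 ?subr_gt0//.
have c0 : 0 < c by move: xc; rewrite /x; lra.
have cb : beta * p%:R * c ^+ p.-1 <= `|beta * p%:R|.
  apply: le_trans (ler_norm _) _; rewrite normrM ler_piMr// ger0_norm; last by rewrite exprn_ge0// ltW.
  by apply: exprn_ile1; exact: ltW.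
have lnM : ln (1 - c) < - M.
  rewrite -(expRK (- M)) ltr_ln ?posrE ?expR_gt0//; last by lra.
  by move: xc; rewrite /x; lra.
have lnp : 0 <= ln (1 + c) by rewrite ln_ge0//; lra.
by rewrite /atanh; move: lnM; rewrite /M; lra.
Qed.

(** 0 is excluded because [H] vanishes there, and 1 by [H1_lt_sup]. For even [p] the sign is free by
    symmetry; for odd [p], [0 < H beta p y <= beta * y ^ p] forces [y > 0]. *)
Lemma maximizer_norm beta p y : (0 < p)%N -> beta_star p < beta ->
  y \in `[-1, 1] -> H beta p y = sup_H beta p `[-1, 1] ->
  [/\ 0 < `|y| < 1, H beta p `|y| = sup_H beta p `[-1, 1],
      y ^+ p = `|y| ^+ p & odd p -> 0 < y].
Proof.
move=> p0 hb yin ymax; have [b0 S0] := beta_star_lt p0 hb.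
have nin : `|y| \in `[-1, 1].
  move: yin; rewrite !in_itv/= -ler_norml => ->.
  by rewrite andbT; apply: le_trans (normr_ge0 _).
have y0 : y != 0 by apply: contra_ltN S0 => /eqP y0; rewrite -ymax y0 H_at0.
have opos : odd p -> 0 < y.
  move=> po; rewrite lt0r y0 /= leNgt; apply/negP => yneg.
  have : 0 < y ^+ p.
    by rewrite -(pmulr_rgt0 _ b0); apply: lt_le_trans (H_le beta p yin); rewrite ymax.
  by rewrite exprn_odd_gt0// ltNge ltW.
have yp : y ^+ p = `|y| ^+ p.
  have [/opos yp|pe] := boolP (odd p); first by rewrite gtr0_norm.
  by rewrite -normrX ger0_norm// exprn_even_ge0.
have nmax : H beta p `|y| = sup_H beta p `[-1, 1].
  rewrite -ymax; have [/opos yp0|pe] := boolP (odd p); first by rewrite gtr0_norm.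
  by have [_|_] := ger0P y; rewrite ?HN_even.
split => //; rewrite normr_gt0 y0 /= lt_neqAle.
move: yin; rewrite in_itv/= -ler_norml => ->; rewrite andbT.
by apply: contra_eqN nmax => /eqP ->; rewrite lt_eqF// H1_lt_sup.
Qed.

(** Between two maximizers Rolle's theorem gives another critical point; [atanh_over_pow] would
    equal [beta * p] at all three, against strict quasiconvexity. *)
Lemma maximizer_unique beta p u v : (0 < p)%N -> 0 < u < 1 -> 0 < v < 1 ->
  H beta p u = sup_H beta p `[-1, 1] ->
  H beta p v = sup_H beta p `[-1, 1] -> u = v.
Proof.
move=> p0; wlog uv : u v / u < v => [hw|] u01 v01 umax vmax.
  have [uv|vu|//] := ltgtP u v; first exact: hw.
  by apply/esym; exact: hw.
have us := maximizer_stationary u01 umax; have vs := maximizer_stationary v01 vmax.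
move: (u01) (v01) => /andP[u0 u1] /andP[v0 v1].
have [|c [/andP[uc cv] E]] := mvt_strict uv (f := H beta p)
    (df := fun t => beta * p%:R * t ^+ p.-1 - atanh t).
  by move=> x /andP[ux xv]; apply: is_derive_H; apply/andP; split; lra.
have := atanh_over_pow_quasiconvex p.-1 u0 uc cv v1.
have c0 : 0 < c by lra.
rewrite us vs maxxx /atanh_over_pow exprVn ltr_pdivrMl ?exprn_gt0// => ca.
have : H beta p v - H beta p u = 0 by rewrite umax vmax subrr.
rewrite E => /eqP; rewrite mulf_eq0 !subr_eq0 (gt_eqF uv) orbF => /eqP h.
by move: ca; rewrite -h mulrC ltxx.
Qed.

(** The absolute value of any maximizer qualifies, so [xget] does not fall back on its default. *)
Lemma m_starP beta p : (0 < p)%N -> beta_star p < beta ->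
  0 < m_star beta p < 1 /\ H beta p (m_star beta p) = sup_H beta p `[-1, 1].
Proof.
move=> p0 hb; have [y yin ymax] := sup_H_attained beta p.
have [y01 nmax _ _] := maximizer_norm p0 hb yin ymax.
rewrite /m_star; case: xgetP => [m -> [/= m01 mmax]|/(_ `|y|) []].
  split => //; apply/eqP; rewrite eq_le -{2}ymax mmax// andbT.
  apply: H_le_sup; rewrite in_itv/=; move: m01 => /andP[m0 m1].
  by apply/andP; split; lra.
by split => // x xin; rewrite nmax; exact: H_le_sup.
Qed.

Lemma maximizer_pow beta p y : (0 < p)%N -> beta_star p < beta ->
  y \in `[-1, 1] -> H beta p y = sup_H beta p `[-1, 1] ->
  y ^+ p = m_star beta p ^+ p.
Proof.
move=> p0 hb yin ymax; have [y01 nmax -> _] := maximizer_norm p0 hb yin ymax.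
have [m01 mmax] := m_starP p0 hb.
by rewrite (maximizer_unique p0 y01 m01 nmax mmax).
Qed.

(** The near-covering form of compactness, applied to the filter of positive reals at 0;
    monotonicity in [e] lets a local tolerance serve all smaller ones. *)
Lemma segment_uniform (a b : R) (Q : R -> R -> Prop) :
  (forall r e x, r <= e -> Q e x -> Q r x) ->
  (forall y, y \in `[a, b] -> exists2 e : R, 0 < e & \forall x \near y, Q e x) ->
  exists2 e : R, 0 < e & forall x, x \in `[a, b] -> Q e x.
Proof.
move=> Qle Qloc; have cov := (compact_near_coveringP _).1 (@segment_compact R a b).
have /(_ _)/(_ _) near_e := cov R (0 : R)^'+ Q _.
have : \forall e \near (0 : R)^'+, `[a, b]%classic `<=` Q e.
  apply: near_e => y yin; have [e e0 Qe] := Qloc y yin.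
  exists ([set x | Q e x], [set r | r <= e]); first split => //=.
    exact: nbhs_right_le.
  by move=> [x r] /= [Qx re]; exact: Qle Qx.
move=> H0; near (0 : R)^'+ => e; exists e; first by near: e; exact: nbhs_right_gt.
by near: e.
Unshelve. all: by end_near. Qed.

End Maximizers.

(** * Likelihood of an exponential family *)

Lemma is_derive_bigsum (R : realType) (T : Type) (s : seq T) (g dg : T -> R -> R) (x : R) :
  (forall i, is_derive x 1 (g i) (dg i x)) ->
  is_derive x 1 (fun t => \sum_(i <- s) g i t) (\sum_(i <- s) dg i x).
Proof.
move=> dgi; elim: s => [|i s IH].
  rewrite big_nil (_ : (fun t => _) = cst 0); first exact: is_derive_cst.
  by apply/funext => t; rewrite big_nil.
rewrite big_cons (_ : (fun t => _) = g i + (fun t => \sum_(i <- s) g i t)).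
  exact: is_deriveD.
by apply/funext => t; rewrite big_cons.
Qed.

Section ExponentialFamily.
Context {R : realType} {T : finType}.
Implicit Types (h : T -> R) (X Y Z : T) (t b : R).

(** The reciprocal of the likelihood of [X]: a plain sum of exponentials, to be minimized. *)
Definition expfam_inv h X t : R := \sum_Z expR (t * (h Z - h X)).

Definition expfam_lik h X t : R := expR (t * h X) / \sum_Z expR (t * h Z).

Lemma expfam_inv_gt h X Z t : Z != X -> expR (t * (h Z - h X)) < expfam_inv h X t.
Proof.
move=> ZX; rewrite /expfam_inv (bigD1 Z)//= ltrDl (bigD1 X) 1?eq_sym//=.
by rewrite ltr_wpDr ?expR_gt0// sumr_ge0// => ? _; exact: expR_ge0.
Qed.

Lemma expfam_inv_gt0 h X t : 0 < expfam_inv h X t.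
Proof.
by rewrite /expfam_inv (bigD1 X)//= ltr_wpDr ?expR_gt0// sumr_ge0// => ? _; exact: expR_ge0.
Qed.

Lemma expfam_likE h X t : expfam_lik h X t = (expfam_inv h X t)^-1.
Proof.
rewrite /expfam_lik /expfam_inv -invf_div; congr (_^-1).
rewrite mulr_suml; apply: eq_bigr => Z _.
by rewrite mulrBr expRB.
Qed.

Lemma expfam_lik_gt0 h X t : 0 < expfam_lik h X t.
Proof. by rewrite expfam_likE invr_gt0 expfam_inv_gt0. Qed.

Lemma is_derive_expfam_inv h X t : is_derive t 1 (expfam_inv h X)
  (\sum_Z (h Z - h X) * expR (t * (h Z - h X))).
Proof.
apply: (@is_derive_bigsum _ _ _ (fun Z t => expR (t * (h Z - h X)))
  (fun Z t => (h Z - h X) * expR (t * (h Z - h X)))) => Z.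
set c := h Z - h X.
have d1 : is_derive t 1 (fun t : R => t * c) c.
  have := is_deriveM (is_derive_id t (1 : R)) (is_derive_cst c t 1).
  by move=> /is_derive_eq; apply; rewrite /GRing.scale/= mulr0 add0r mulr1.
have := is_derive1_comp (is_derive_expR _) d1.
by rewrite mulrC.
Qed.

Lemma continuous_expfam_inv h X : continuous (expfam_inv h X).
Proof.
move=> t; apply: differentiable_continuous; apply/derivable1_diffP.
by have [] := is_derive_expfam_inv h X t.
Qed.

(** One term of the sum blows up at each end of the line, so a minimizer over a large segment is
    global. *)
Lemma expfam_inv_min h X Z Z' : h Z < h X -> h X < h Z' ->
  exists b, forall t, expfam_inv h X b <= expfam_inv h X t.
Proof.
move=> ZX XZ'.
pose N := expfam_inv h X 0; have N0 : 0 < N by exact: expfam_inv_gt0.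
(* Outside [-M, M] some exponent exceeds [N], the value at 0, and then so does its exponential. *)
pose M := N / (h X - h Z) + N / (h Z' - h X).
have M1 : 0 < N / (h X - h Z) by rewrite divr_gt0// subr_gt0.
have M2 : 0 < N / (h Z' - h X) by rewrite divr_gt0// subr_gt0.
have [b bM bmin] := @EVT_min R (expfam_inv h X) (- M) M ltac:(rewrite /M; lra)
  (continuous_subspaceT (@continuous_expfam_inv h X)).
have far V t : V != X -> N <= t * (h V - h X) -> expfam_inv h X b <= expfam_inv h X t.
  move=> VX Nt; apply: (@le_trans _ _ N).
    by apply: bmin; rewrite in_itv/= /M; apply/andP; split; lra.
  apply/ltW/(lt_trans _ (expfam_inv_gt h t VX)).
  by apply: le_lt_trans Nt _; apply: lt_le_trans (expR_ge1Dx _); rewrite ltrDr.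
exists b => t; have [tM|tM] := ltP t (- M).
  apply: (far Z); first by apply: contraTneq ZX => ->; rewrite ltxx.
  rewrite -mulrNN opprB -ler_pdivrMr ?subr_gt0//; move: tM; rewrite /M; lra.
have [Mt|Mt] := ltP M t; last by apply: bmin; rewrite in_itv/= tM.
apply: (far Z'); first by apply: contraTneq XZ' => ->; rewrite ltxx.
rewrite -ler_pdivrMr ?subr_gt0//; move: Mt; rewrite /M; lra.
Qed.

(** No term of [expfam_inv h X] increases with [t] and that of [Z] strictly decreases, so the
    likelihood is strictly increasing. *)
Lemma expfam_lik_max h X Z : h Z < h X -> (forall Y, h Y <= h X) ->
  (forall t, exists t', expfam_lik h X t < expfam_lik h X t') /\
  expfam_lik h X t @[t --> +oo] --> sup (range (expfam_lik h X)).
Proof.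
move=> ZX Xmax.
have dec t t' : t < t' -> expfam_inv h X t' < expfam_inv h X t.
  move=> tt'; rewrite /expfam_inv (bigD1 Z)//= [ltRHS](bigD1 Z)//=.
  apply: ltr_leD; first by rewrite ltr_expR ltr_nM2r ?subr_lt0.
  by apply: ler_sum => Y _; rewrite ler_expR ler_wnM2r ?subr_le0// ltW.
have inc t t' : t < t' -> expfam_lik h X t < expfam_lik h X t'.
  by move=> tt'; rewrite !expfam_likE ltf_pV2 ?posrE ?expfam_inv_gt0// dec.
split; first by move=> t; exists (t + 1); apply: inc; rewrite ltrDl.
apply: nondecreasing_cvgr.
  by move=> t t'; rewrite le_eqVlt => /predU1P[->//|/inc/ltW].
exists 1 => _ [t _ <-]; rewrite /expfam_lik ler_pdivrMr ?mul1r.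
  by rewrite (bigD1 X)//= lerDl sumr_ge0// => ? _; exact: expR_ge0.
by rewrite (bigD1 X)//= ltr_wpDr ?expR_gt0// sumr_ge0// => ? _; exact: expR_ge0.
Qed.

(** The term of [Y] drives the likelihood to 0 at [+oo], whereas its supremum is positive. *)
Lemma expfam_lik_max_only h X Y : h X < h Y ->
  ~ expfam_lik h X t @[t --> +oo] --> sup (range (expfam_lik h X)).
Proof.
move=> XY; set s := sup _ => cv.
have YX : Y != X by apply: contraTneq XY => ->; rewrite ltxx.
have s0 : 0 < s.
  apply: lt_le_trans (expfam_lik_gt0 h X 0) _; apply: ub_le_sup; last by exists 0.
  exists 1 => _ [t _ <-]; rewrite /expfam_lik ler_pdivrMr ?mul1r.
    by rewrite (bigD1 X)//= lerDl sumr_ge0// => ? _; exact: expR_ge0.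
  by rewrite (bigD1 X)//= ltr_wpDr ?expR_gt0// sumr_ge0// => ? _; exact: expR_ge0.
have D0 : 0 < h Y - h X by rewrite subr_gt0.
near (+oo_R)%R => t.
have : s / 2 < expfam_lik h X t.
  near: t; apply: (cvgr_gt _ cv); rewrite ltr_pdivrMr//; lra.
have t0 : (2 / s) / (h Y - h X) < t by near: t; apply: nbhs_pinfty_gt; exact: num_real.
rewrite expfam_likE ltNge => /negP; apply.
rewrite -(invf_div 2 s) lef_pV2 ?posrE ?divr_gt0 ?expfam_inv_gt0//.
apply/ltW/(lt_trans _ (expfam_inv_gt h t YX)).
apply: lt_le_trans (expR_ge1Dx _).
by move: t0; rewrite ltr_pdivrMr//; lra.
Unshelve. all: by end_near. Qed.

(** Reflecting the parameter carries the results at [+oo] over to [-oo]. *)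
Lemma expfam_likN h X : expfam_lik (fun Z => - h Z) X = (expfam_lik h X) \o -%R.
Proof.
apply/funext => t; rewrite /expfam_lik/= mulrN mulNr; congr (_ / _).
by apply: eq_bigr => Z _; rewrite mulrN mulNr.
Qed.

Lemma range_expfam_likN h X :
  range (expfam_lik (fun Z => - h Z) X) = range (expfam_lik h X).
Proof.
rewrite expfam_likN; apply/seteqP; split => [_ [t _ <-]|_ [t _ <-]].
  by exists (- t).
by exists (- t) => //=; rewrite opprK.
Qed.

(** The reciprocal likelihood of [Y] is that of [X] times a strictly decreasing function of [t],
    which excludes [b' < b]. If [b = b'], the two first-order conditions would differ by a nonzero
    multiple of [expfam_inv]. *)
Lemma expfam_argmax_lt h X Y b b' : h X < h Y ->
  (forall t, expfam_lik h X t <= expfam_lik h X b) ->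
  (forall t, expfam_lik h Y t <= expfam_lik h Y b') -> b < b'.
Proof.
move=> XY bmax b'max.
have minX t : expfam_inv h X b <= expfam_inv h X t.
  by have := bmax t; rewrite !expfam_likE lef_pV2 ?posrE ?expfam_inv_gt0.
have minY t : expfam_inv h Y b' <= expfam_inv h Y t.
  by have := b'max t; rewrite !expfam_likE lef_pV2 ?posrE ?expfam_inv_gt0.
have XYE t : expfam_inv h Y t = expfam_inv h X t * expR (- (t * (h Y - h X))).
  rewrite /expfam_inv mulr_suml; apply: eq_bigr => Z _; rewrite -expRD.
  by congr expR; ring.
have stat V c : (forall t, expfam_inv h V c <= expfam_inv h V t) ->
    \sum_Z (h Z - h V) * expR (c * (h Z - h V)) = 0.
  move=> cmin.
  have : is_derive c 1 (expfam_inv h V) 0.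
    apply: (@derive1_at_min _ _ (c - 1) (c + 1)); [by lra| | |].
    - by move=> t _; have [] := is_derive_expfam_inv h V t.
    - by rewrite in_itv/=; apply/andP; split; lra.
    - by move=> t _.
  move=> d; rewrite -(@derive_val _ _ _ _ _ _ _ (is_derive_expfam_inv h V c)).
  exact: (@derive_val _ _ _ _ _ _ _ d).
have [//|b'b|bb'] := ltgtP b b'; exfalso.
  have := minY b; rewrite !XYE leNgt => /negP; apply.
  have e0 := expR_gt0 (- (b * (h Y - h X))).
  apply: (@le_lt_trans _ _ (expfam_inv h X b' * expR (- (b * (h Y - h X))))).
    by rewrite ler_pM2r.
  rewrite ltr_pM2l ?expfam_inv_gt0// ltr_expR ltrN2 ltr_pM2r// subr_gt0//.
have := stat _ _ minX; have := stat _ _ minY; rewrite -bb' => sY sX.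
have : \sum_Z (h Z - h Y) * expR (b * (h Z - h Y)) =
   (\sum_Z (h Z - h X) * expR (b * (h Z - h X)) - (h Y - h X) * expfam_inv h X b) *
   expR (- (b * (h Y - h X))).
  rewrite /expfam_inv mulr_sumr -sumrB mulr_suml; apply: eq_bigr => Z _.
  rewrite -mulrBl -mulrA -expRD; congr (_ * expR _); ring.
rewrite sX sY sub0r => /esym/eqP; rewrite mulf_eq0 expR_eq0 orbF oppr_eq0 mulf_eq0.
by rewrite (gt_eqF (expfam_inv_gt0 _ _ _)) orbF subr_eq0 (gt_eqF XY).
Qed.

End ExponentialFamily.

(** * Existence and monotonicity of the maximum likelihood estimator *)

Section MLE.
Context {R : realType}.
Implicit Types (p n : nat) (b : \bar R).

Lemma cw_pmf_expfam p n (X : config n) :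
  (fun t : R => cw_pmf p t X) = expfam_lik (@hamiltonian R p n) X.
Proof. by apply/funext => t; rewrite cw_pmfE. Qed.

Lemma is_mleE p n (X : config n) b : is_mle p X b =
  let lik := expfam_lik (@hamiltonian R p n) X in
  let unattained := forall t, exists t', lik t < lik t' in
  match b with
  | r%:E => forall t, lik t <= lik r
  | +oo%E => unattained /\ lik t @[t --> +oo] --> sup (range lik)
  | -oo%E => unattained /\ lik t @[t --> -oo] --> sup (range lik)
  end.
Proof.
rewrite /is_mle -cw_pmf_expfam.
by case: b.
Qed.

(** The maximizer is [-oo], [+oo] or finite according to whether the energy of [X] is minimal,
    maximal or in between; [A] and [B] exclude a constant energy. *)
Lemma is_mle_exists p n (X A B : config n) :
  hamiltonian p A < hamiltonian p B :> R -> exists b : \bar R, is_mle p X b.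
Proof.
set h := @hamiltonian R p n => AB.
have [[Z ZX]|noZ] := pselect (exists Z, h Z < h X); last first.
  have Xmin Z : - h Z <= - h X.
    by rewrite lerN2 leNgt; apply/negP => ZX; apply: noZ; exists Z.
  have XB : h X < h B by apply: le_lt_trans AB; rewrite -lerN2.
  have [un cv] := @expfam_lik_max _ _ (fun Z => - h Z) X B ltac:(by rewrite ltrN2) Xmin.
  exists -oo%E; rewrite is_mleE -/h; split.
    move=> t; have [t'] := un (- t).
    by rewrite expfam_likN /= opprK => ?; exists (- t').
  apply/cvgNy_compNP; rewrite range_expfam_likN in cv.
  by rewrite expfam_likN in cv.
have [[Z' XZ']|noZ'] := pselect (exists Z, h X < h Z); last first.
  have Xmax Y : h Y <= h X.
    by rewrite leNgt; apply/negP => YX; apply: noZ'; exists Y.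
  by exists +oo%E; rewrite is_mleE; exact: expfam_lik_max ZX Xmax.
have [b bmin] := expfam_inv_min ZX XZ'.
exists b%:E; rewrite is_mleE /= => t.
by rewrite !expfam_likE lef_pV2 ?posrE ?expfam_inv_gt0.
Qed.

(** [Y] has more energy than [X], so [b] is not [+oo] and [b'] is not [-oo]; [expfam_argmax_lt]
    settles the finite case. *)
Lemma is_mle_lt p n (X Y : config n) (b b' : \bar R) :
  hamiltonian p X < hamiltonian p Y :> R ->
  is_mle p X b -> is_mle p Y b' -> (b < b')%E.
Proof.
set h := @hamiltonian R p n => XY; rewrite !is_mleE /= -/h.
have noNy : ~ expfam_lik h Y t @[t --> -oo] --> sup (range (expfam_lik h Y)).
  move=> /cvgNy_compNP; rewrite -expfam_likN -range_expfam_likN.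
  by apply: (@expfam_lik_max_only _ _ _ Y X); rewrite ltrN2.
case: b => [b||]; case: b' => [b'||] //=.
- by move=> bm b'm; rewrite lte_fin; exact: expfam_argmax_lt XY bm b'm.
- by move=> _ _; rewrite ltry.
- by move=> _ [_ /noNy].
- by move=> [_ /(expfam_lik_max_only XY)].
- by move=> [_ /(expfam_lik_max_only XY)].
- by move=> [_ /(expfam_lik_max_only XY)].
- by move=> _ _; rewrite ltNyr.
- by move=> _ [_ /noNy].
Qed.

Lemma hamiltonian_nonconstant p n : (0 < p)%N -> (1 < n)%N ->
  exists A B : config n, hamiltonian p A < hamiltonian p B :> R.
Proof.
move=> p0 n1; have n0 : (0 < n)%N by exact: ltnW.
(* All spins up against a single spin down: the means are 1 and 1 - 2/n, and [n >= 2] keeps the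
   latter in [0,1), so that their powers compare for every [p]. *)
pose B : config n := [ffun=> true].
pose A : config n := [ffun i => i != Ordinal n0].
have nR : 0 < n%:R :> R by rewrite ltr0n.
have mB : sample_mean B = 1 :> R.
  rewrite /sample_mean (eq_bigr (fun=> 1)); last by move=> i _; rewrite /spin ffunE.
  by rewrite sumr_const card_ord mulVf// lt0r_neq0.
have mA : sample_mean A = 1 - 2 / n%:R :> R.
  rewrite /sample_mean (bigD1 (Ordinal n0))//= (eq_bigr (fun=> 1)); last first.
    by move=> i i0; rewrite /spin ffunE i0.
  rewrite sumr_const cardC1 card_ord /spin ffunE eqxx/= -subn1 natrB//.
  by field; rewrite lt0r_neq0.
exists A, B; rewrite !hamiltonianE// mB mA expr1n ltr_pM2l//.
have n2 : 2 / n%:R <= 1 :> R by rewrite ler_pdivrMr// mul1r ler_nat.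
have n3 : 0 < 2 / n%:R :> R by rewrite divr_gt0.
by rewrite exprn_ilt1 -?lt0n//; lra.
Qed.

Lemma beta_ML_lt p n (X Y : config n) : (0 < p)%N -> (1 < n)%N ->
  ((beta_ML p X : \bar R) < beta_ML p Y)%E = (sample_mean X ^+ p < sample_mean Y ^+ p :> R).
Proof.
move=> p0 n1; have n0 : (0 < n)%N by exact: ltnW.
have [A [B AB]] := hamiltonian_nonconstant p0 n1.
have nR : 0 < n%:R :> R by rewrite ltr0n.
have mleP (Z : config n) : is_mle p Z (beta_ML p Z : \bar R).
  by have [b bZ] := is_mle_exists Z AB; rewrite /beta_ML; exact: (xgetPex 0%E (ex_intro _ b bZ)).
have lt (Z W : config n) : sample_mean Z ^+ p < sample_mean W ^+ p :> R ->
    (beta_ML p Z < beta_ML p W :> \bar R)%E.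
  move=> ZW; apply: is_mle_lt (mleP Z) (mleP W).
  by rewrite !hamiltonianE// ltr_pM2l.
have [/lt//|/lt YX|XY] := ltgtP (sample_mean X ^+ p : R) (sample_mean Y ^+ p).
  by apply/negbTE; rewrite -leNgt ltW.
(* Equal energies give the same likelihood function, hence the same set of maximizers, from which
   [xget] makes the same choice. *)
suff -> : beta_ML p X = beta_ML p Y :> \bar R by rewrite ltxx.
rewrite /beta_ML; congr xget; apply/funext => b; rewrite /= !is_mleE.
have -> // : expfam_lik (@hamiltonian R p n) X = expfam_lik (@hamiltonian R p n) Y.
by apply/funext => t; rewrite /expfam_lik !hamiltonianE// XY.
Qed.

End MLE.

(** * Maximum likelihood *)

Section MLSeparation.
Context {R : realType}.
Implicit Types (p n : nat) (beta x y u e s kappa : R) (A U : set R).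

Lemma le_sup_H beta p A x : A `<=` [set` `[-1, 1]] -> A x -> H beta p x <= sup_H beta p A.
Proof.
move=> A1 Ax; apply: ub_le_sup; last by exists x.
by exists (sup_H beta p `[-1, 1]) => _ [y /A1 y1 <-]; exact: H_le_sup.
Qed.

Lemma sup_H_adherent beta p A e : A `<=` [set` `[-1, 1]] -> A !=set0 -> 0 < e ->
  exists2 y, A y & sup_H beta p A - e <= H beta p y.
Proof.
move=> A1 [x Ax] e0.
have supA : has_sup [set H beta p x | x in A].
  split; first by exists (H beta p x), x.
  by exists (sup_H beta p `[-1, 1]) => _ [y /A1 y1 <-]; exact: H_le_sup.
by have [_ [y Ay <-] sy] := sup_adherent e0 supA; exists y => //; exact: ltW.
Qed.

(** Here [y] is in the closure of [A] and [H] is continuous; this extends bounds to the boundary of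
    the threshold sets. *)
Lemma H_le_sup_H_near beta p A y : A `<=` [set` `[-1, 1]] ->
  (forall U, nbhs y U -> exists2 x, A x & U x) -> H beta p y <= sup_H beta p A.
Proof.
move=> A1 Ay; rewrite leNgt; apply/negP => sy.
have [x Ax] := Ay _ (cvgr_gt _ (@continuous_H R beta p y) _ sy).
by rewrite ltNge le_sup_H.
Qed.

(** By compactness [H] stays a fixed amount below its supremum away from the maximizers, which is
    the source of exponential concentration. *)
Lemma sup_gap beta p (a b : R) U : `[a, b] `<=` `[-1, 1] ->
  (forall y, y \in `[a, b] -> H beta p y = sup_H beta p `[-1, 1] ->
     \forall x \near y, U x) ->
  exists2 kappa, 0 < kappa &
    forall x, x \in `[a, b] -> U x \/ H beta p x <= sup_H beta p `[-1, 1] - kappa.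
Proof.
move=> ab Umax; apply: segment_uniform => [r e x re [Ux|Hx]|y yin].
- by left.
- by right; apply: (le_trans Hx); rewrite lerD2l lerN2.
have [ymax|ymax] := eqVneq (H beta p y) (sup_H beta p `[-1, 1]).
  by exists 1 => //; apply: filterS (Umax y yin ymax) => x; left.
have yS : H beta p y < sup_H beta p `[-1, 1].
  by rewrite lt_neqAle ymax H_le_sup//; exact: ab.
exists ((sup_H beta p `[-1, 1] - H beta p y) / 2).
  by rewrite divr_gt0// subr_gt0.
near=> x; right; apply/ltW; near: x.
apply: (cvgr_lt _ (@continuous_H R beta p y)); lra.
Unshelve. all: by end_near. Qed.

Lemma sup_H_lt beta p A kappa : A !=set0 -> 0 < kappa ->
  (forall x, A x -> H beta p x <= sup_H beta p `[-1, 1] - kappa) ->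
  sup_H beta p A < sup_H beta p `[-1, 1].
Proof.
move=> [a Aa] k0 HA; apply: (@le_lt_trans _ _ (sup_H beta p `[-1, 1] - kappa)).
  by apply: ge_sup; [exists (H beta p a), a|move=> _ [x Ax <-]; exact: HA].
by rewrite ltrBlDr ltrDl.
Qed.

(** Adding the optimality of [u] under [beta0] and of [v] under [beta] leaves
    [(beta - beta0) * (v ^ p - u ^ p) >= 0]. If [u = v], stationarity would make both parameters
    equal. *)
Lemma maximizer_increasing beta0 beta p u v : (0 < p)%N -> beta0 < beta ->
  0 < u < 1 -> 0 < v < 1 ->
  H beta0 p u = sup_H beta0 p `[-1, 1] -> H beta p v = sup_H beta p `[-1, 1] ->
  u < v.
Proof.
move=> p0 bb u01 v01 umax vmax.
have in1 x : 0 < x < 1 -> x \in `[-1, 1].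
  by move=> /andP[x0 x1]; rewrite in_itv/=; apply/andP; split; lra.
have hv := H_le_sup beta0 p (in1 _ v01); have hu := H_le_sup beta p (in1 _ u01).
rewrite -umax /H in hv; rewrite -vmax /H in hu.
have upow : u ^+ p <= v ^+ p.
  by rewrite -(@ler_pM2l _ (beta - beta0)) ?subr_gt0//; lra.
move: (u01) (v01) => /andP[u0 u1] /andP[v0 v1].
rewrite lt_neqAle -(@ler_pXn2r _ p) ?nnegrE ?(ltW u0) ?(ltW v0)// upow andbT.
apply/eqP => uv; have := maximizer_stationary u01 umax.
rewrite uv (maximizer_stationary v01 vmax) => /eqP.
by rewrite -subr_eq0 -mulrBl mulf_eq0 pnatr_eq0 (gtn_eqF p0) orbF subr_eq0 (gt_eqF bb).
Qed.

Let above_m_star p beta : set R := [set x | x \in `[-1, 1] /\ m_star beta p < x].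

Let above_m_star_sub p beta : above_m_star p beta `<=` [set` `[-1, 1]].
Proof. by move=> x []. Qed.

Let above_m_star_nonempty p beta : m_star beta p < 1 -> 0 < m_star beta p ->
  above_m_star p beta !=set0.
Proof. by move=> m1 m0; exists 1; split => //; rewrite in_itv/=; lra. Qed.

(** By [maximizer_increasing] the null maximizers satisfy the open condition
    [x ^ p < m_star beta p ^ p], which fails on the set of the second supremum. *)
Lemma beta_ML_slope_gt0 p beta0 beta : (0 < p)%N -> beta_star p < beta0 -> beta0 < beta ->
  0 < sup_H beta0 p `[-1, 1] - sup_H beta0 p [set x | x \in `[-1, 1] /\ m_star beta p < x].
Proof.
move=> p0 h0 h1; have [m01 mmax] := m_starP p0 (lt_trans h0 h1).
move: (m01) => /andP[m0 m1].
have [|kappa k0 gap] := @sup_gap beta0 p (-1) 1 [set x | x ^+ p < m_star beta p ^+ p] (fun _ => id).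
  move=> y yin ymax; have [y01 nmax yp _] := maximizer_norm p0 h0 yin ymax.
  have ym := maximizer_increasing p0 h1 y01 m01 nmax mmax.
  apply: (cvgr_lt _ (@exprn_continuous R p y)).
  by rewrite yp ltr_pXn2r ?nnegrE// ltW.
rewrite subr_gt0; apply: (sup_H_lt (above_m_star_nonempty m1 m0) k0) => x [xin mx].
have [/=|//] := gap x xin.
by rewrite ltr_pXn2r ?nnegrE ?(ltW m0)// ?ltNge ?(ltW mx)// ltW// (lt_trans m0).
Qed.

Lemma beta_ML_exponential_rate p beta0 beta : (0 < p)%N -> beta_star p < beta ->
  exponential_rate p (beta_ML p) beta0 beta
    (sup_H beta0 p `[-1, 1] - sup_H beta0 p [set x | x \in `[-1, 1] /\ m_star beta p < x]).
Proof.
move=> p0 hb; have [m01 mmax] := m_starP p0 hb.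
move: (m01) => /andP[m0 m1]; set m := m_star beta p in m01 mmax m0 m1 *.
apply: exponential_rate_of_separation => e e0.
set s := sup_H _ _ [set x | _].
have [y [yin my] sy] := @sup_H_adherent beta0 p (above_m_star p beta) e (@above_m_star_sub p beta) (above_m_star_nonempty m1 m0) e0.
have mpos := exprn_gt0 p m0.
have mpy : m ^+ p < y ^+ p by rewrite ltr_pXn2r ?nnegrE ?(ltW m0)// ltW// (lt_trans m0).
have [r /= r0 yr] : exists2 r : R, 0 < r & forall x, `|x - y| < r -> (m ^+ p + y ^+ p) / 2 < x ^+ p.
  have mid : (m ^+ p + y ^+ p) / 2 < y ^+ p by rewrite ltr_pdivrMr//; lra.
  have : \forall x \near y, (m ^+ p + y ^+ p) / 2 < x ^+ p.
    exact: (cvgr_gt _ (@exprn_continuous R p y)).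
  move=> /nbhs_ballP[r /= r0 yr].
  by exists r => // x xy; apply: yr; rewrite /ball/= distrC.
have [rho2 rho20 far] : exists2 rho : R, 0 < rho & forall x, x \in `[-1, 1] ->
    H beta0 p x <= s + e \/ x ^+ p <= m ^+ p - rho.
  apply: segment_uniform => [a b x ab [?|h]|z zin]; [by left| |].
    by right; apply: (le_trans h); rewrite lerD2l lerN2.
  have [Hz|Hz] := ltP (H beta0 p z) (s + e).
    exists 1 => //; near=> x; left; apply/ltW; near: x.
    exact: (cvgr_lt _ (@continuous_H R beta0 p z)).
  (* The point [m] itself is a limit of points above it, since [m < 1]. *)
  have above w : w \in `[-1, 1] -> m <= w -> H beta0 p w <= s.
    move=> win; rewrite le_eqVlt => /predU1P[<-|mw]; last first.
      by apply: (@le_sup_H beta0 p (above_m_star p beta)) => //; exact: above_m_star_sub.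
    apply: (@H_le_sup_H_near beta0 p (above_m_star p beta)); first exact: above_m_star_sub.
    move=> U /nbhs_ballP[d /= d0 dU].
    pose t := Num.min (d / 2) ((1 - m) / 2).
    have t0 : 0 < t by rewrite lt_min !divr_gt0// subr_gt0.
    have td : t <= d / 2 by rewrite ge_min lexx.
    have tm : t <= (1 - m) / 2 by rewrite ge_min lexx orbT.
    exists (m + t); first by split; [rewrite in_itv/=; apply/andP; split; lra|rewrite -/m; lra].
    by apply: dU; rewrite /ball/= opprD addrA subrr sub0r normrN gtr0_norm//; lra.
  have zm : z ^+ p < m ^+ p.
    rewrite ltNge; apply/negP => mz.
    have [zpos|zneg] := leP 0 z.
      rewrite ler_pXn2r ?nnegrE ?(ltW m0)// in mz.
      by have := above z zin mz; lra.
    (* A negative [z] whose power is at least [m ^ p > 0] needs [p] even, and then [above] applies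
       to [- z]. *)
    have pe : ~~ odd p.
      by apply/negP => po; have := lt_le_trans mpos mz; rewrite exprn_odd_gt0// ltNge ltW.
    have Nz : m <= - z.
      rewrite -(@ler_pXn2r _ p) ?nnegrE ?(ltW m0) ?oppr_ge0 ?(ltW zneg)//.
      by rewrite exprNn -signr_odd (negbTE pe) mul1r.
    have Nzin : - z \in `[-1, 1].
      by move: zin; rewrite !in_itv/= => /andP[? ?]; apply/andP; split; lra.
    by have := above _ Nzin Nz; rewrite HN_even//; lra.
  exists ((m ^+ p - z ^+ p) / 2); first by rewrite divr_gt0// subr_gt0.
  near=> x; right; apply/ltW; near: x.
  by apply: (cvgr_lt _ (@exprn_continuous R p z)); lra.
(* The first bound keeps the power of the mean of [X] below the midpoint exceeded near [y]; the
   second rules out the other alternative of [far] for a rejecting [Y]. *)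
pose rho := Num.min ((y ^+ p - m ^+ p) / 2) rho2.
have rho0 : 0 < rho by rewrite lt_min rho20 divr_gt0// subr_gt0.
have rho1 : rho <= (y ^+ p - m ^+ p) / 2 by rewrite ge_min lexx.
have rho2' : rho <= rho2 by rewrite ge_min lexx orbT.
have [|kappa k0 gap] := @sup_gap beta p (-1) 1 [set x | `|x ^+ p - m ^+ p| < rho] (fun _ => id).
  move=> z zin zmax; rewrite -(maximizer_pow p0 hb zin zmax).
  have /cvgrPdist_lt /(_ _ rho0) := @exprn_continuous R p z.
  by apply: filterS => x; rewrite distrC.
exists y, r, kappa, [set x | `|x ^+ p - m ^+ p| < rho]; split => //.
near=> n => X Y /= XU.
have n1 : (1 < n)%N by near: n; exact: nbhs_infty_gt.
rewrite beta_ML_lt//; move: XU; rewrite ltr_norml => /andP[X1 X2]; split.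
  by move=> /yr; lra.
move=> XY; have Yin : sample_mean Y \in `[-1 : R, 1].
  by rewrite sample_meanE ?lattice_mean_itv ?ups_le// ltnW.
by have [//|] := far _ Yin; lra.
Unshelve. all: by end_near. Qed.

End MLSeparation.

(** * Maximum pseudolikelihood *)

Section MPLSeparation.
Context {R : realType}.
Implicit Types (p n q : nat) (beta x y u e s t kappa : R) (A U : set R).

Lemma atanhe_fin t : -1 < t < 1 -> atanhe t = (atanh t)%:E.
Proof.
by move=> /andP[t0 t1]; rewrite /atanhe !lne_EFin ?subr_gt0//; lra.
Qed.

Lemma eta_fin p x : (0 < p)%N -> -1 < x < 1 -> x != 0 ->
  eta p x = (p%:R^-1 * atanh_over_pow p.-1 x)%:E.
Proof.
move=> p0 x1 x0; rewrite /eta (negbTE x0) atanhe_fin// -EFinM /atanh_over_pow mulrA; congr ((_ * _ * _)%:E).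
rewrite (_ : 1 - p%:Z = - p.-1%:Z); first by rewrite -exprnN exprVn.
by rewrite -[in LHS](prednK p0) -addn1 PoszD opprD addrCA subrr addr0.
Qed.

Lemma atanh_over_powN q x : atanh_over_pow q (- x) = (-1) ^+ q.+1 * atanh_over_pow q x.
Proof. rewrite /atanh_over_pow atanhN invrN [in LHS]exprNn exprS mulN1r mulrN.
by rewrite mulNr -[X in - X = _]mulrA. Qed.

Lemma atanhe1 : atanhe (1 : R) = +oo%E.
Proof.
rewrite /atanhe subrr lne_EFin ?addr_gt0// le0_lneNy//=.
by rewrite gt0_muley// lte_fin invr_gt0.
Qed.

Lemma atanheN1 : atanhe (-1 : R) = -oo%E.
Proof.
rewrite /atanhe subrr opprK le0_lneNy// lne_EFin ?addr_gt0//=.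
by rewrite gt0_muleNy// lte_fin invr_gt0.
Qed.

Lemma eta1 p : (0 < p)%N -> eta p (1 : R) = +oo%E.
Proof.
move=> p0; rewrite /eta oner_eq0 atanhe1 exp1rz mulr1 gt0_muley//.
by rewrite lte_fin invr_gt0 ltr0n.
Qed.

Lemma etaN1 p : (0 < p)%N -> eta p (-1 : R) = if odd p then -oo%E else +oo%E.
Proof.
move=> p0; rewrite /eta oppr_eq0 oner_eq0 atanheN1.
have pV : 0 < p%:R^-1 :> R by rewrite invr_gt0 ltr0n.
have -> : (-1 : R) ^ (1 - p%:Z) = (-1) ^+ (~~ odd p).
  rewrite expfzDr ?oppr_eq0 ?oner_eq0// expr1z -exprnN -[in LHS]signr_odd.
  by case: (odd p) => /=; rewrite ?expr0 ?expr1 ?invrN ?invr1 ?mulr1 ?mulrNN ?mulr1.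
case: (odd p) => /=.
  by rewrite expr0 mulr1 gt0_muleNy// lte_fin.
by rewrite expr1 mulrN1 lt0_muleNy// lte_fin oppr_lt0.
Qed.

Lemma eta_even p x : (0 < p)%N -> ~~ odd p -> x \in `[-1, 1] -> eta p (- x) = eta p x.
Proof.
move=> p0 pe; rewrite in_itv/= => /andP[x1 x2].
have [->|x0] := eqVneq x 0; first by rewrite oppr0.
move: x1; rewrite le_eqVlt => /predU1P[<-|x1]; first by rewrite opprK etaN1// eta1// (negbTE pe).
move: x2; rewrite le_eqVlt => /predU1P[->|x2]; first by rewrite etaN1// eta1// (negbTE pe).
rewrite !eta_fin// ?oppr_eq0//; [|by apply/andP; split; lra..].
by rewrite atanh_over_powN prednK// -signr_odd (negbTE pe) mul1r.
Qed.

Lemma eta_odd_le0 p x : odd p -> -1 <= x <= 0 -> (eta p x <= 0)%E.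
Proof.
move=> po /andP[x1 x2]; have p0 : (0 < p)%N by exact: odd_gt0.
have [->|x0] := eqVneq x 0; first by rewrite /eta eqxx.
move: x1; rewrite le_eqVlt => /predU1P[<-|x1]; first by rewrite etaN1// po leNye.
have xneg : x < 0 by rewrite lt_neqAle x0.
rewrite eta_fin//; last by apply/andP; split; lra.
rewrite lee_fin -[x]opprK atanh_over_powN prednK// -signr_odd po expr1 mulN1r mulrN oppr_le0.
apply: mulr_ge0 => //; rewrite /atanh_over_pow mulr_ge0//.
  by rewrite exprn_ge0// invr_ge0; lra.
by apply/ltW/atanh_gt0/andP; split; lra.
Qed.

Lemma eta_preimage_gt_sub p beta : eta_preimage_gt p beta `<=` [set` `[-1, 1]].
Proof. by move=> x []. Qed.

Lemma eta_preimage_gtP p beta x : (0 < p)%N -> 0 < x < 1 ->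
  eta_preimage_gt p beta x <-> beta * p%:R < atanh_over_pow p.-1 x.
Proof.
move=> p0 x01; move: (x01) => /andP[x0 x1].
have xin : x \in `[-1, 1] by rewrite in_itv/=; apply/andP; split; lra.
rewrite /eta_preimage_gt/= eta_fin//; [|by apply/andP; split; lra|by rewrite lt0r_neq0].
rewrite ltry andbT lte_fin ltr_pdivlMl ?ltr0n// mulrC.
by split=> [[]|].
Qed.

(** Negative points occur only for even [p], where everything is symmetric. 0 is excluded by
    [0 < beta], and infinite endpoint values by the definition of the preimage. *)
Lemma eta_preimage_gt_norm p beta beta0 x : (0 < p)%N -> 0 < beta ->
  eta_preimage_gt p beta x ->
  [/\ 0 < `|x| < 1, eta_preimage_gt p beta `|x| & H beta0 p `|x| = H beta0 p x].
Proof.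
move=> p0 b0 [xin /andP[bx xy]].
have x0 : x != 0.
  by apply: contraTneq bx => ->; rewrite /eta eqxx lte_fin -leNgt ltW.
have [xneg|xpos] := ltP x 0.
  have pe : ~~ odd p.
    apply/negP => po; move: bx; apply/negP; rewrite -leNgt.
    apply: (@le_trans _ _ 0%E); last by rewrite lee_fin ltW.
    by apply: eta_odd_le0 => //; move: xin; rewrite in_itv/= (ltW xneg) => /andP[->].
  have x1 : x != -1 by apply: contraTneq xy => ->; rewrite etaN1// (negbTE pe) ltxx.
  move: (xin); rewrite in_itv/= => /andP[xl xr].
  rewrite ltr0_norm// HN_even// /eta_preimage_gt/= eta_even// bx xy; split => //.
    by rewrite oppr_gt0 xneg ltrNl lt_neqAle eq_sym x1.
  by split => //; rewrite in_itv/=; apply/andP; split; lra.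
have x1 : x != 1 by apply: contraTneq xy => ->; rewrite eta1// ltxx.
rewrite ger0_norm//; split => //; last by split=> //; rewrite bx.
by move: xin; rewrite in_itv/= => /andP[_ x1']; rewrite !lt_neqAle eq_sym x0 x1 xpos.
Qed.

Lemma atanh_over_pow_ge q x : 0 < x < 1 -> atanh x <= atanh_over_pow q x.
Proof.
move=> x01; rewrite /atanh_over_pow ler_peMl ?(ltW (atanh_gt0 x01))//.
by move: x01 => /andP[x0 x1]; rewrite exprn_ege1// invf_ge1// ltW.
Qed.

Lemma eta_preimage_gt_near1 p beta : (0 < p)%N ->
  exists2 d : R, 0 < d < 1 & forall x, 1 - d < x < 1 -> eta_preimage_gt p beta x.
Proof.
move=> p0; pose M := 2 * `|beta * p%:R| + 1.
have M0 : 0 < M by rewrite ltr_wpDl// mulr_ge0.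
have E0 := expR_gt0 (- M).
have E1 : expR (- M) < 1 by rewrite expR_lt1 oppr_lt0.
exists (expR (- M)); first by rewrite E0.
move=> x /andP[x0 x1]; have x01 : 0 < x < 1 by apply/andP; split; lra.
apply/eta_preimage_gtP => //; apply: lt_le_trans (atanh_over_pow_ge _ x01).
have lnM : ln (1 - x) < - M.
  by rewrite -(expRK (- M)) ltr_ln ?posrE ?expR_gt0//; lra.
have lnp : 0 <= ln (1 + x) by rewrite ln_ge0//; lra.
have := ler_norm (beta * p%:R).
by rewrite /atanh; move: lnM; rewrite /M; lra.
Qed.

Lemma eta_preimage_gt_nonempty p beta : (0 < p)%N -> eta_preimage_gt p beta !=set0.
Proof.
move=> p0; have [d d01 dV] := eta_preimage_gt_near1 beta p0.
by exists (1 - d / 2); apply: dV; apply/andP; split; lra.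
Qed.

(* Points where [eta p] equals [beta] are limits of points where it exceeds
   [beta]: by quasiconvexity it has no local maximum. *)
Lemma H_le_sup_eta_preimage p beta0 beta y : (0 < p)%N ->
  0 < y <= 1 -> (y < 1 -> beta * p%:R <= atanh_over_pow p.-1 y) ->
  H beta0 p y <= sup_H beta0 p (eta_preimage_gt p beta).
Proof.
move=> p0 /andP[y0 y1] yb; apply: H_le_sup_H_near; first exact: eta_preimage_gt_sub.
move=> U /nbhs_ballP[r /= r0 rU].
move: y1; rewrite le_eqVlt => /predU1P[y1|y1].
  have [d /andP[d0 d1] dV] := eta_preimage_gt_near1 beta p0.
  pose t := Num.min (r / 2) (d / 2).
  have t0 : 0 < t by rewrite lt_min !divr_gt0.
  have tr : t <= r / 2 by rewrite ge_min lexx.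
  have td : t <= d / 2 by rewrite ge_min lexx orbT.
  exists (1 - t); first by apply: dV; apply/andP; split; lra.
  by apply: rU; rewrite /ball/= y1 opprB addrCA subrr addr0 gtr0_norm//; lra.
(* Keeps [y - t] and [y + t] both in the ball and in (0,1). *)
pose t := Num.min (r / 2) (Num.min (y / 2) ((1 - y) / 2)).
have t0 : 0 < t by rewrite !lt_min !divr_gt0// subr_gt0.
have tr : t <= r / 2 by rewrite ge_min lexx.
have ty : t <= y / 2 by rewrite !ge_min lexx orbT.
have t1 : t <= (1 - y) / 2 by rewrite !ge_min lexx !orbT.
have := @atanh_over_pow_quasiconvex _ p.-1 (y - t) y (y + t) ltac:(lra) ltac:(lra) ltac:(lra) ltac:(lra).
rewrite lt_max => /orP[h|h]; [exists (y - t)|exists (y + t)].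
- by apply/eta_preimage_gtP => //; [apply/andP; split; lra|exact: le_lt_trans (yb y1) h].
- by apply: rU; rewrite /ball/= opprB addrCA subrr addr0 gtr0_norm//; lra.
- by apply/eta_preimage_gtP => //; [apply/andP; split; lra|exact: le_lt_trans (yb y1) h].
- by apply: rU; rewrite /ball/= opprD addrA subrr sub0r normrN gtr0_norm//; lra.
Qed.

(** For [p >= 3], [atanh x / x ^ (p - 1)] exceeds [x ^ (2 - p)] on (0,1) and blows up at 0, so 0 is
    a limit of points of the preimage. *)
Lemma H_le_sup_eta_preimage0 p beta0 beta : (2 < p)%N -> 0 < beta ->
  H beta0 p 0 <= sup_H beta0 p (eta_preimage_gt p beta).
Proof.
move=> p2 b0; have p0 : (0 < p)%N by apply: leq_trans p2.
apply: H_le_sup_H_near; first exact: eta_preimage_gt_sub.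
move=> U /nbhs_ballP[r /= r0 rU].
have bp : 0 < beta * p%:R by rewrite mulr_gt0// ltr0n.
pose t := Num.min (r / 2) (Num.min (2^-1) ((beta * p%:R)^-1)).
have t0 : 0 < t by rewrite !lt_min !invr_gt0 bp ltr0n divr_gt0.
have tr : t <= r / 2 by rewrite ge_min lexx.
have t2 : t <= 2^-1 by rewrite !ge_min lexx orbT.
have tb : t <= (beta * p%:R)^-1 by rewrite !ge_min lexx !orbT.
have t01 : 0 < t < 1 by apply/andP; split; lra.
exists t; last by apply: rU; rewrite /ball/= sub0r normrN gtr0_norm//; lra.
apply/eta_preimage_gtP => //.
apply: (@le_lt_trans _ _ (t^-1 ^+ p.-1 * t)); last first.
  by rewrite /atanh_over_pow ltr_pM2l ?exprn_gt0 ?invr_gt0// atanh_gt.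
apply: (@le_trans _ _ t^-1).
  by rewrite -[leLHS]invrK lef_pV2 ?posrE ?invr_gt0.
rewrite (_ : p.-1 = (p - 3).+2); last by rewrite -{1}(subnK p2) addn3.
rewrite exprSr mulfVK ?lt0r_neq0// exprSr ler_peMl ?invr_ge0 ?(ltW t0)//.
by rewrite exprn_ege1// invf_ge1//; lra.
Qed.

(** Points of (0,1] with [eta p >= beta], and 0 when [p > 2], are limits of points of the preimage,
    so the null [H] is at most [s] there. Compactness makes the remaining gap uniform on [0,1], and
    parity treats negative points. *)
Lemma eta_le_off_sup p beta0 beta e : (1 < p)%N -> beta_star p < beta0 -> beta0 < beta ->
  0 < e -> exists2 rho : R, 0 < rho & forall x, x \in `[-1, 1] ->
    H beta0 p x <= sup_H beta0 p (eta_preimage_gt p beta) + e \/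
    (eta p x <= (beta - rho)%:E)%E.
Proof.
move=> p1 h0 h1 e0; have p0 : (0 < p)%N by exact: ltnW.
have [b00 _] := beta_star_lt p0 h0; have b0 : 0 < beta by apply: lt_trans h1.
have pR : 0 < p%:R :> R by rewrite ltr0n.
set s := sup_H _ _ _.
(* Membership in [0,1] is repeated inside the property because [segment_uniform] asks for a full
   neighbourhood in the line. *)
have [rho rho0 Hrho] : exists2 rho : R, 0 < rho & forall x, x \in `[0, 1] ->
    x \in `[0, 1] -> H beta0 p x <= s + e \/ (eta p x <= (beta - rho)%:E)%E.
  apply: segment_uniform => [a b x ab Hx /Hx[?|h]|y]; [by left| |].
    by right; apply: (le_trans h); rewrite lee_fin lerD2l lerN2.
  rewrite in_itv/= => /andP[y0 y1].
  have [Hy|Hy] := ltP (H beta0 p y) (s + e).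
    exists 1 => //; near=> x => _; left; apply/ltW; near: x.
    exact: (cvgr_lt _ (@continuous_H R beta0 p y)).
  have yb : 0 < y -> y < 1 /\ atanh_over_pow p.-1 y < beta * p%:R.
    move=> yp; have y01 : 0 < y <= 1 by rewrite yp.
    have [y1'|y1'] := ltP y 1.
      split => //; rewrite ltNge; apply/negP => by_.
      by have := H_le_sup_eta_preimage beta0 p0 y01 (fun _ => by_); rewrite -/s; lra.
    have yb' : y < 1 -> beta * p%:R <= atanh_over_pow p.-1 y by rewrite ltNge y1'.
    by have := H_le_sup_eta_preimage beta0 p0 y01 yb'; rewrite -/s; lra.
  move: y0; rewrite le_eqVlt => /predU1P[y0|y0]; last first.
    have [y1' ylt] := yb y0.
    exists ((beta - p%:R^-1 * atanh_over_pow p.-1 y) / 2).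
      by rewrite divr_gt0// subr_gt0 ltr_pdivrMl// mulrC.
    have y01 : 0 < y < 1 by rewrite y0.
    near=> x => _; right; rewrite eta_fin//; last 2 first.
    - have : 0 < x by near: x; exact: lt_nbhsr.
      have : x < 1 by near: x; exact: lt_nbhsl.
      by move=> ? ?; apply/andP; split; lra.
    - have x0 : 0 < x by near: x; exact: lt_nbhsr.
      by rewrite lt0r_neq0.
    rewrite lee_fin ler_pdivrMl//; apply/ltW; near: x.
    apply: (cvgr_lt _ (@continuous_atanh_over_pow _ p.-1 _ y01)).
    rewrite mulrC -ltr_pdivrMr// mulrC.
    have : p%:R^-1 * atanh_over_pow p.-1 y < beta by rewrite ltr_pdivrMl// mulrC.
    by move: (p%:R^-1 * _) => w; lra.
  have [p2|p2] := ltnP 2 p.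
    by have := H_le_sup_eta_preimage0 beta0 p2 b0; rewrite -/s y0; lra.
  have {p1 p2 Hy yb} p2 : p = 2%N by apply/eqP; rewrite eqn_leq p2.
  (* For [p = 2], [eta 2] tends to 1/2 at 0, and 1/2 < beta0 because
     [beta0 = eta 2 u > 1/2] at a maximizer [u]. *)
  have [u uin umax] := sup_H_attained beta0 p.
  have [u01 nmax _ _] := maximizer_norm p0 h0 uin umax.
  have half : 1 < 2 * beta0.
    have := maximizer_stationary u01 nmax; rewrite p2 mulrC => <-.
    rewrite /atanh_over_pow expr1 ltr_pdivlMl ?mulr1 ?atanh_gt//.
    by case/andP: u01.
  (* The goal becomes [eta 2 x <= beta0]. It follows from [atanh x <= x / (1 - x ^ 2)] once
     [1 - x >= 1 / (2 * beta0)], which defines [d]. *)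
  exists (beta - beta0); first by rewrite subr_gt0.
  pose d := 1 - (2 * beta0)^-1.
  have d0 : 0 < d by rewrite subr_gt0 invf_lt1// (lt_trans ltr01).
  have d1 : d < 1 by rewrite /d ltrBlDr ltrDl invr_gt0 (lt_trans ltr01).
  near=> x; rewrite in_itv/= => /andP[x0 x1]; right.
  have xd : x < d by near: x; apply: lt_nbhsl; rewrite -y0.
  rewrite opprB addrCA subrr addr0.
  move: x0; rewrite le_eqVlt => /predU1P[<-|x0].
    by rewrite /eta eqxx lee_fin ltW.
  have x01 : 0 < x < 1 by rewrite x0; lra.
  rewrite eta_fin//; [|by apply/andP; split; lra|by rewrite lt0r_neq0].
  rewrite lee_fin p2 /atanh_over_pow expr1 ler_pdivrMl// ler_pdivrMl//.
  apply: (le_trans (atanh_le x01)); rewrite ler_pM2l//.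
  have b2 : 0 < 2 * beta0 by lra.
  rewrite -[leRHS]invrK lef_pV2 ?posrE ?invr_gt0//; last by nra.
  by move: xd; rewrite /d; nra.
(* Capping by [beta] covers negative points for odd [p], where [eta p <= 0]. *)
have minP : 0 < Num.min rho beta by rewrite lt_min rho0.
have m1 : Num.min rho beta <= rho by rewrite ge_min lexx.
have m2 : Num.min rho beta <= beta by rewrite ge_min lexx orbT.
exists (Num.min rho beta) => // x xin.
have weak (t : \bar R) : (t <= (beta - rho)%:E)%E -> (t <= (beta - Num.min rho beta)%:E)%E.
  by move=> /le_trans; apply; rewrite lee_fin lerD2l lerN2.
move: (xin); rewrite in_itv/= => /andP[xl xr].
have [x0|x0] := leP 0 x.
  have x01 : x \in `[0, 1] by rewrite in_itv/= x0.
  by have [?|/weak ?] := Hrho x x01 x01; [left|right].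
have [po|pe] := boolP (odd p).
  right; apply: (@le_trans _ _ 0%E).
    by apply: eta_odd_le0 => //; rewrite xl ltW.
  by rewrite lee_fin subr_ge0.
have x01 : - x \in `[0, 1] by rewrite in_itv/=; apply/andP; split; lra.
have := Hrho _ x01 x01; rewrite HN_even// eta_even// => -[?|/weak ?]; by [left|right].
Unshelve. all: by end_near. Qed.

(** Stationarity gives [eta p = beta] at the maximizer in (0,1), so [sup_gap] applies on [0,1];
    parity extends the gap to negative points. *)
Lemma eta_near_gap p beta rho : (0 < p)%N -> beta_star p < beta -> 0 < rho ->
  exists2 kappa, 0 < kappa & forall x, x \in `[-1, 1] ->
    ((beta - rho)%:E < eta p x < (beta + rho)%:E)%E \/
    H beta p x <= sup_H beta p `[-1, 1] - kappa.
Proof.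
move=> p0 hb rho0; have [b0 S0] := beta_star_lt p0 hb.
have pR : 0 < p%:R :> R by rewrite ltr0n.
have [||kappa k0 gap] := @sup_gap _ beta p 0 1
  [set x | ((beta - rho)%:E < eta p x < (beta + rho)%:E)%E].
- by move=> x; rewrite /= !in_itv/= => /andP[? ?]; apply/andP; split; lra.
- move=> y; rewrite in_itv/= => /andP[y0 y1] ymax.
  have yin : y \in `[-1, 1] by rewrite in_itv/=; apply/andP; split; lra.
  have [+ _ _ _] := maximizer_norm p0 hb yin ymax; rewrite ger0_norm// => y01.
  have ystat := maximizer_stationary y01 ymax.
  have cont := @continuous_atanh_over_pow _ p.-1 _ y01.
  move: y01 => /andP[{}y0 {}y1].
  near=> x; have x0 : 0 < x by near: x; exact: lt_nbhsr.
  have x1 : x < 1 by near: x; exact: lt_nbhsl.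
  rewrite /= eta_fin//; [|by apply/andP; split; lra|by rewrite lt0r_neq0].
  rewrite !lte_fin ltr_pdivlMl// ltr_pdivrMl//; apply/andP; split; near: x.
    by apply: (cvgr_gt _ cont); rewrite ystat mulrC ltr_pM2r//; lra.
  by apply: (cvgr_lt _ cont); rewrite ystat mulrC ltr_pM2l//; lra.
set S := sup_H _ _ _ in S0 gap *.
(* Capping by [S] covers negative points for odd [p], where [H <= 0]. *)
have minP : 0 < Num.min kappa S by rewrite lt_min k0.
have m1 : Num.min kappa S <= kappa by rewrite ge_min lexx.
have m2 : Num.min kappa S <= S by rewrite ge_min lexx orbT.
exists (Num.min kappa S) => // x xin.
move: (xin); rewrite in_itv/= => /andP[xl xr].
have [x0|x0] := leP 0 x.
  have x01 : x \in `[0, 1] by rewrite in_itv/= x0.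
  by have [?|?] := gap x x01; [left|right; lra].
have [po|pe] := boolP (odd p).
  right; apply: (@le_trans _ _ 0); last by rewrite subr_ge0.
  apply: le_trans (H_le beta p xin) _; rewrite pmulr_rle0//.
  by rewrite exprn_odd_le0// ltW.
have x01 : - x \in `[0, 1] by rewrite in_itv/=; apply/andP; split; lra.
have := gap _ x01; rewrite /= HN_even// eta_even// => -[?|?]; [by left|right; lra].
Unshelve. all: by end_near. Qed.

(** At the null maximizers [eta p] equals [beta0 < beta], so a neighbourhood of each avoids the
    preimage. *)
Lemma beta_MPL_slope_gt0 p beta0 beta : (0 < p)%N -> beta_star p < beta0 -> beta0 < beta ->
  0 < sup_H beta0 p `[-1, 1] - sup_H beta0 p (eta_preimage_gt p beta).
Proof.
move=> p0 h0 h1; have [b00 _] := beta_star_lt p0 h0.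
have b0 : 0 < beta by apply: lt_trans h1.
have [|kappa k0 gap] := @sup_gap _ beta0 p (-1) 1 [set x | ~ eta_preimage_gt p beta x] (fun _ => id).
  move=> y yin ymax; have [y01 nmax _ _] := maximizer_norm p0 h0 yin ymax.
  have ystat := maximizer_stationary y01 nmax.
  have cont := @continuous_atanh_over_pow _ p.-1 _ y01.
  have lt_b : atanh_over_pow p.-1 `|y| < beta * p%:R by rewrite ystat ltr_pM2r// ltr0n.
  have nc : `|x| @[x --> y] --> `|y| by exact: norm_continuous.
  have near_b : \forall x \near y, atanh_over_pow p.-1 `|x| < beta * p%:R.
    exact: (cvgr_lt _ (cvg_comp _ _ nc cont) _ lt_b).
  apply: filterS near_b => x xb Vx.
  have [x01 Vn _] := eta_preimage_gt_norm beta0 p0 b0 Vx.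
  by move/(eta_preimage_gtP beta p0 x01): Vn; rewrite ltNge ltW.
rewrite subr_gt0; apply: (sup_H_lt (eta_preimage_gt_nonempty beta p0) k0) => x Vx.
by have [|//] := gap x (eta_preimage_gt_sub Vx).
Qed.

Lemma beta_MPL_exponential_rate p beta0 beta : (1 < p)%N ->
  beta_star p < beta0 -> beta0 < beta ->
  exponential_rate p (beta_MPL p) beta0 beta
    (sup_H beta0 p `[-1, 1] - sup_H beta0 p (eta_preimage_gt p beta)).
Proof.
move=> p1 h0 h1; have p0 : (0 < p)%N by exact: ltnW.
have [b00 _] := beta_star_lt p0 h0; have b0 : 0 < beta by apply: lt_trans h1.
have pR : 0 < p%:R :> R by rewrite ltr0n.
apply: exponential_rate_of_separation => e e0.
have [v Vv sv] := @sup_H_adherent _ beta0 p (eta_preimage_gt p beta) e (@eta_preimage_gt_sub p beta) (eta_preimage_gt_nonempty beta p0) e0.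
(* The absolute value has the same null [H] and lies in (0,1), where [eta p] is continuous. *)
have [y01 Vy Hy] := eta_preimage_gt_norm beta0 p0 b0 Vv.
move: (`|v|) y01 Vy Hy => y y01 /(eta_preimage_gtP beta p0 y01) by_ Hy.
pose rho1 := (p%:R^-1 * atanh_over_pow p.-1 y - beta) / 2.
have rho10 : 0 < rho1 by rewrite divr_gt0// subr_gt0 ltr_pdivlMl// mulrC.
have [r r0 yr] : exists2 r : R, 0 < r &
    forall x, `|x - y| < r -> ((beta + rho1)%:E < eta p x)%E.
  have cont := @continuous_atanh_over_pow _ p.-1 _ y01.
  move: (y01) => /andP[y0 y1].
  have : \forall x \near y, ((beta + rho1)%:E < eta p x)%E.
    near=> x; have x0 : 0 < x by near: x; exact: lt_nbhsr.
    have x1 : x < 1 by near: x; exact: lt_nbhsl.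
    rewrite /= eta_fin//; [|by apply/andP; split; lra|by rewrite lt0r_neq0].
    rewrite lte_fin ltr_pdivlMl//; near: x; apply: (cvgr_gt _ cont).
    by rewrite -ltr_pdivlMl// /rho1; move: rho10; rewrite /rho1; move: (p%:R^-1 * _) => w; lra.
  move=> /nbhs_ballP[r /= r0 rU]; exists r => // x xy.
  by apply: rU; rewrite /ball/= distrC.
have [rho2 rho20 off] := eta_le_off_sup p1 h0 h1 e0.
(* [rho1] places typical samples below every sample with mean near [y]; [rho2] rules out the other
   alternative of [off] for a rejecting [Y]. *)
have rho0 : 0 < Num.min rho1 rho2 by rewrite lt_min rho10.
have [kappa k0 gap] := eta_near_gap p0 (lt_trans h0 h1) rho0.
set rho := Num.min rho1 rho2 in rho0 gap.
have m1 : rho <= rho1 by rewrite ge_min lexx.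
have m2 : rho <= rho2 by rewrite ge_min lexx orbT.
exists y, r, kappa, [set x | ((beta - rho)%:E < eta p x < (beta + rho)%:E)%E]; split => //.
  split => //; last by rewrite Hy.
  by rewrite in_itv/=; move: y01 => /andP[? ?]; apply/andP; split; lra.
near=> n => X Y /= /andP[X1 X2].
have n0 : (0 < n)%N by near: n; exact: nbhs_infty_gt.
rewrite /beta_MPL; split.
  by move=> /yr; apply: lt_trans; apply: lt_le_trans X2 _; rewrite lee_fin lerD2l.
move=> XY; have Yin : sample_mean Y \in `[-1 : R, 1].
  by rewrite sample_meanE ?lattice_mean_itv ?ups_le.
have [//|h] := off _ Yin.
have := lt_trans X1 (lt_le_trans XY h).
by rewrite lte_fin; lra.
Unshelve. all: by end_near. Qed.

End MPLSeparation.

Theorem theorem1 (R : realType) (p : nat) (beta0 beta : R)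
    (hp : (2 <= p)%N) (h0 : beta_star p < beta0) (h1 : beta0 < beta) :
  [/\ is_bahadur_slope p (beta_MPL p) beta0 beta
        (2 * (sup_H beta0 p `[-1, 1]
              - sup_H beta0 p (eta_preimage_gt p beta))),
      is_bahadur_slope p (beta_ML p) beta0 beta
        (2 * (sup_H beta0 p `[-1, 1]
              - sup_H beta0 p [set x | x \in `[-1, 1] /\ m_star beta p < x])) &
      forall (d : measure_display) (Omega : measurableType d)
        (P : probability Omega R) (X : forall n, Omega -> config n),
        cw_samples p beta P X ->
        {ae P, forall w, sample_size_equiv p (beta_MPL p) beta0
           (fun n => X n w)
           (fun delta => ln delta /
              (sup_H beta0 p (eta_preimage_gt p beta)
               - sup_H beta0 p `[-1, 1]))}
        /\
        {ae P, forall w, sample_size_equiv p (beta_ML p) beta0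
           (fun n => X n w)
           (fun delta => ln delta /
              (sup_H beta0 p [set x | x \in `[-1, 1] /\ m_star beta p < x]
               - sup_H beta0 p `[-1, 1]))}].
Proof.
have p0 : (0 < p)%N by exact: ltnW.
have rMPL := beta_MPL_exponential_rate hp h0 h1.
have rML := @beta_ML_exponential_rate _ p beta0 beta p0 (lt_trans h0 h1).
split; [exact: exponential_rate_slope..|].
move=> d Omega P X HX; split; rewrite -opprB.
  exact: exponential_rate_sample_size (beta_MPL_slope_gt0 p0 h0 h1) rMPL HX.
exact: exponential_rate_sample_size (beta_ML_slope_gt0 p0 h0 h1) rML HX.
Qed.
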